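(* Suppose $T\in\mathcal{B}(l^2(\mathbb{N}))$ is invertible and that we are given a family of functions $\{g^j\}_{j\in\mathbb{N}}$ controlling the decay of the columns of $T$ as described in the context. Suppose also that we are given a bound $C$ such that $\|T\|\le C$. Let $\epsilon>0$ and $m,n\in\mathbb{N}$. Then we can choose $j$ (effectively, from the given information) such that, computing $P_mT_{(j),n}P_m$ by the finite Householder procedure applied to the section $P_{g^j_n(m)}T_{(j)}P_{g^j_n(m)}$ (with the phase normalization that the diagonal entries of the upper triangular factors are positive), where $g^j_n$ is the $n$-fold iterate of $g^j$, we have the guaranteed bound $$\|P_mT_nP_m-P_mT_{(j),n}P_m\|\le\epsilon,$$ where $T_n$ and $T_{(j),n}$ denote the $n$-th IQR iterates of $T$ and $T_{(j)}$ respectively.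
   Context: $\{e_j\}$ is the canonical basis of $l^2(\mathbb{N})$ and $P_m$ the orthogonal projection onto $\mathrm{span}\{e_1,\dots,e_m\}$. The matrix entries $\langle Te_j,e_i\rangle$ are available. Column decay: $\{g^j\}_{j\in\mathbb{N}}$ is an increasing family of increasing functions $g^j:\mathbb{N}\to\mathbb{N}$ that can be evaluated, such that the infinite matrix $T_{(j)}$ with columns $\{P_{g^j(n)}Te_n\}_{n\in\mathbb{N}}$ is invertible, $\|(P_{g^j(n)}-I)Te_n\|\le1/j$ for all $n$, and (as the paper arranges without loss of generality before the theorem, by increasing the $g^j$ and passing to subsequences) $\|T_{(j)}-T\|\le1/j$. Note that $\langle T_{(j)}e_n,e_i\rangle=0$ for $i>g^j(n)$. IQR iterates: for an invertible operator $B$ there is a unique decomposition $B=QR$ with $Q$ unitary and $R$ invertible upper triangular ($\langle Re_j,e_i\rangle=0$ for $i>j$) with strictly positive diagonal entries. Put $B_0=B$, $B_{i-1}=Q_iR_i$ (this decomposition), $B_i=R_iQ_i$; $B_n$ is the $n$-th IQR iterate. $T_n$ is the iterate with $B=T$ and $T_{(j),n}$ the iterate with $B=T_{(j)}$. Finite procedure: if $\langle Be_i,e_l\rangle=0$ for $l>f(i)$, with $f$ non-decreasing and $f(n)\ge n$, then $P_mB_nP_m$ is determined by, and computed with finitely many Householder transformations (equivalently Gram--Schmidt on columns) from, the finite section $P_{f_n(m)}BP_{f_n(m)}$, where $f_n$ is the $n$-fold iterate of $f$. ''Effectively'' means that $j$ is found by a finite computation using the matrix entries of $T$, evaluations of the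 $g^j$, and $C,\epsilon,m,n$. *)

(* Defs.v *)
From HB Require Import structures.
From mathcomp Require Import all_boot all_order all_algebra.
From mathcomp Require Import all_classical all_reals all_analysis.
From mathcomp Require Import complex ring.

Set Implicit Arguments.
Unset Strict Implicit.
Unset Printing Implicit Defensive.
Import Order.TTheory GRing.Theory Num.Theory.
Import numFieldNormedType.Exports.
Import ComplexField.

Local Open Scope classical_set_scope.
Local Open Scope ring_scope.

(* Scalars are R[i] with R : realType. Sequences and matrices are indexed     *)
(* from 0, so the basis vector e_n of the 1-based convention is               *)
(* [ebasis n.-1]. The functions g^j and the parameters j, m, n keep their     *)
(* 1-based meaning; the values [g 0 _] and [g _ 0] are unconstrained.         *)

(** * The Hilbert space l^2(N) *)

Section SquareSummable.
Variable R : realType.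
Implicit Types x y : nat -> R[i]^o.

Definition square_summable : {pred nat -> R[i]^o} :=
  fun x => `[< cvgn (series (fun k => Normc.normc (x k) ^+ 2)) >].

Lemma finite_support_summable x (m : nat) :
  (forall k, (m <= k)%N -> x k = 0) -> x \in square_summable.
Proof.
move=> x0; apply/asboolP.
apply/cvg_ex; exists (series (fun k => Normc.normc (x k) ^+ 2) m).
apply: cvg_near_cst; exists m => // n /= mn.
rewrite /series /= (big_cat_nat _ mn) //= [X in _ + X]big_nat.
rewrite [X in _ + X]big1 ?addr0 // => k /andP[mk _].
by rewrite x0 // Normc.normc0 expr0n.
Qed.

Lemma square_summable_submod_closed : submod_closed square_summable.
Proof.
split; first by apply: (@finite_support_summable _ 0).
move=> a x y /asboolP sx /asboolP sy; apply/asboolP.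
pose u : R^nat := (2 * Normc.normc a ^+ 2) *: (fun k => Normc.normc (x k) ^+ 2)
                    + 2 *: (fun k => Normc.normc (y k) ^+ 2).
have nn (z : R[i]) : 0 <= Normc.normc z by case: z => p q; exact: sqrtr_ge0.
apply: (@series_le_cvg _ _ u).
- by move=> k; rewrite sqr_ge0.
- by move=> k; rewrite /u addr_ge0// mulr_ge0// ?sqr_ge0// mulr_ge0// sqr_ge0.
- move=> k; change (Normc.normc (a * x k + y k) ^+ 2 <=
    2 * Normc.normc a ^+ 2 * Normc.normc (x k) ^+ 2
    + 2 * Normc.normc (y k) ^+ 2).
  have H := le_normcD (a * x k) (y k); rewrite Normc.normcM in H.
  apply: (@le_trans _ _ ((Normc.normc a * Normc.normc (x k)
                          + Normc.normc (y k)) ^+ 2)).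
    by rewrite ler_pXn2r// nnegrE ?addr_ge0 ?mulr_ge0 ?nn.
  rewrite -subr_ge0.
  set p := Normc.normc a; set q := Normc.normc (x k).
  set r := Normc.normc (y k).
  have -> : 2 * p ^+ 2 * q ^+ 2 + 2 * r ^+ 2 - (p * q + r) ^+ 2
            = (p * q - r) ^+ 2 by ring.
  exact: sqr_ge0.
- by apply: is_cvg_seriesD; apply: is_cvg_seriesZ.
Qed.

HB.instance Definition _ := GRing.isSubmodClosed.Build R[i] (nat -> R[i]^o)
  square_summable square_summable_submod_closed.

Record l2 := L2 {
  l2val :> nat -> R[i]^o ;
  l2_summable : l2val \in square_summable }.

HB.instance Definition _ := [isSub of l2 for l2val].
HB.instance Definition _ := [Choice of l2 by <:].
HB.instance Definition _ := [SubChoice_isSubLmodule of l2 by <:].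

Definition norm2 (x : l2) : R :=
  Num.sqrt (limn (series (fun k => Normc.normc (x k) ^+ 2))).

(* linear in the first argument *)
Definition inner (x y : l2) : R[i] :=
  Complex (limn (series (fun k => complex.Re (x k * (y k)^*))))
          (limn (series (fun k => complex.Im (x k * (y k)^*)))).

Lemma trunc_summable (m : nat) x :
  (fun k => if (k < m)%N then x k else 0) \in square_summable.
Proof. by apply: (@finite_support_summable _ m) => k; rewrite ltnNge => ->. Qed.

Definition trunc (m : nat) x : l2 := L2 (trunc_summable m x).

(* the orthogonal projection P_m onto the span of the first m basis vectors *)
Definition projP (m : nat) (x : l2) : l2 := trunc m x.

Definition ebasis (k : nat) : l2 := trunc k.+1 (fun i => (i == k)%:R).

End SquareSummable.

(** * Bounded operators *)

Section Operators.
Variable R : realType.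
Implicit Types A B Q S : l2 R -> l2 R.

Definition bounded_linear A : Prop :=
  linear A /\ exists c : R, forall x, norm2 (A x) <= c * norm2 x.

Definition opnorm A : R := sup [set norm2 (A x) | x in [set x | norm2 x <= 1]].

Definition invertible A : Prop :=
  exists A', [/\ bounded_linear A', cancel A A' & cancel A' A].

Definition unitary Q : Prop :=
  [/\ linear Q, forall x y, inner (Q x) (Q y) = inner x y
    & forall y, exists x, Q x = y].

Definition upper_triangular A : Prop :=
  forall i j : nat, (j < i)%N -> inner (A (ebasis R j)) (ebasis R i) = 0.

(* [0 < z] in R[i] means that z is real and strictly positive *)
Definition positive_diagonal A : Prop :=
  forall j : nat, 0 < inner (A (ebasis R j)) (ebasis R j).

Definition is_QR B Q S : Prop :=
  [/\ B = Q \o S, unitary Q & [/\ bounded_linear S, invertible S,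
      upper_triangular S & positive_diagonal S]].

(* An invertible B has exactly one QR decomposition; the default value B of   *)
(* [xget] is only used for a B without any.                                   *)
Definition iqr_step B : l2 R -> l2 R :=
  xget B [set B' | exists Q S, is_QR B Q S /\ B' = S \o Q].

Definition iqr (n : nat) B : l2 R -> l2 R := iter n iqr_step B.

(* the matrix of P_N B P_N in the canonical basis *)
Definition section_mx (N : nat) B : 'M[R[i]]_N :=
  \matrix_(i, k) inner (B (ebasis R k)) (ebasis R i).

(** * Column decay *)

(* T_(j) is [Tj j]; "increasing" is read as non-decreasing. *)
Record column_decay (T : l2 R -> l2 R) (g : nat -> nat -> nat)
    (Tj : nat -> l2 R -> l2 R) : Prop := ColumnDecay {
  decay_family : forall j j' n, (0 < j <= j')%N -> (0 < n)%N ->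
    (g j n <= g j' n)%N ;
  decay_mono : forall j n n', (0 < j)%N -> (0 < n <= n')%N ->
    (g j n <= g j n')%N ;
  decay_bounded : forall j, (0 < j)%N -> bounded_linear (Tj j) ;
  decay_columns : forall j n, (0 < j)%N -> (0 < n)%N ->
    Tj j (ebasis R n.-1) = projP (g j n) (T (ebasis R n.-1)) ;
  decay_invertible : forall j, (0 < j)%N -> invertible (Tj j) ;
  decay_tail : forall j n, (0 < j)%N -> (0 < n)%N ->
    norm2 (projP (g j n) (T (ebasis R n.-1)) - T (ebasis R n.-1)) <= j%:R^-1 ;
  decay_close : forall j, (0 < j)%N ->
    opnorm (fun x => Tj j x - T x) <= j%:R^-1 }.

End Operators.

(** * The finite Householder procedure *)

Section Householder.
Variable R : realType.
Local Notation C := R[i].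
Local Open Scope sesquilinear_scope.

Definition vnorm (N : nat) (x : 'cV[C]_N) : C :=
  (Num.sqrt (\sum_l Normc.normc (x l 0) ^+ 2))%:C%C.

Definition phase (z : C) : C := if z == 0 then 1 else z / `|z|.

(* I - (2 / ||v||^2) v v^*, which is I when v = 0 *)
Definition reflection (N : nat) (v : 'cV[C]_N) : 'M[C]_N :=
  1%:M - (2 / vnorm v ^+ 2) *: (v *m v^t*).

(* The Householder transformation that annihilates the entries of column i of *)
(* A below the diagonal, acting only on coordinates >= i.                     *)
Definition householder (N : nat) (i : 'I_N) (A : 'M[C]_N) : 'M[C]_N :=
  let x : 'cV[C]_N := \col_l (if (i <= l)%N then A l i else 0) in
  reflection (x + (phase (A i i) * vnorm x) *: delta_mx i 0).

(* The same followed by the multiplication of row i by the unit scalar that   *)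
(* makes the diagonal entry nonnegative.                                      *)
Definition householder_pos (N : nat) (i : 'I_N) (A : 'M[C]_N) : 'M[C]_N :=
  let H := householder i A in
  diag_mx (\row_l (if l == i then (phase ((H *m A) i i))^* else 1)) *m H.

(* The unitary U such that the first K columns of U A are upper triangular. *)
Definition householder_unitary (N K : nat) (A : 'M[C]_N) : 'M[C]_N :=
  foldl (fun U i => householder_pos i (U *m A) *m U) 1%:M
        [seq i : 'I_N <- enum 'I_N | (i < K)%N].

(* the leading K x K block; it is only used for K <= N *)
Definition leading (N K : nat) (A : 'M[C]_N) : 'M[C]_K :=
  \matrix_(i, k) if (insub (i : nat), insub (k : nat)) is (Some i', Some k')
                 then A i' k' else 0.

Definition householder_step (N K : nat) (A : 'M[C]_N) : 'M[C]_K :=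
  let U := householder_unitary K A in leading K (U *m A *m U^t*).

(* From the section of size f_n(m) of B, pass successively to the sections of *)
(* sizes f_(n-1)(m), ..., f_0(m) = m of B_1, ..., B_n.                        *)
Fixpoint householder_iqr (f : nat -> nat) (n m : nat) :
    'M[C]_(iter n f m) -> 'M[C]_m :=
  match n with
  | 0 => fun A => A
  | n'.+1 => fun A => householder_iqr (householder_step (iter n' f m) A)
  end.

End Householder.
Arguments householder_iqr {R} f n m A.

(** * Finite computations *)

(* Exact arithmetic over the complex numbers (field operations, conjugation   *)
(* and comparisons) with oracles for the data of the problem. Terms of        *)
(* Goedel's system T are the terminating computations; an algorithm adds one  *)
(* unbounded search (Kleene normal form). A term contains no real or complex  *)
(* constant and does not depend on the data.                                  *)

Inductive ty := TyNat | TyNum | TyArr of ty & ty.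
Declare Scope ty_scope.
Delimit Scope ty_scope with ty.
Bind Scope ty_scope with ty.
Infix "~>" := TyArr (at level 70, right associativity) : ty_scope.

Inductive var : seq ty -> ty -> Type :=
| VarZ G a : var (a :: G) a
| VarS G a b : var G a -> var (b :: G) a.

Inductive tm (G : seq ty) : ty -> Type :=
| TmVar a of var G a : tm G a
| TmLam a b of tm (a :: G) b : tm G (a ~> b)
| TmApp a b of tm G (a ~> b) & tm G a : tm G b
| TmZero : tm G TyNat
| TmSucc : tm G (TyNat ~> TyNat)
| TmRec a : tm G (a ~> (TyNat ~> a ~> a) ~> TyNat ~> a)
| TmOfNat : tm G (TyNat ~> TyNum)
| TmAdd : tm G (TyNum ~> TyNum ~> TyNum)
| TmOpp : tm G (TyNum ~> TyNum)
| TmMul : tm G (TyNum ~> TyNum ~> TyNum)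
| TmInv : tm G (TyNum ~> TyNum)
| TmConj : tm G (TyNum ~> TyNum)
| TmLeq : tm G (TyNum ~> TyNum ~> TyNat)
| TmEntry : tm G (TyNat ~> TyNat ~> TyNum)
| TmControl : tm G (TyNat ~> TyNat ~> TyNat)
| TmBound : tm G TyNum
| TmEps : tm G TyNum
| TmParM : tm G TyNat
| TmParN : tm G TyNat.

Record input (R : realType) := Input {
  in_entry : nat -> nat -> R[i] ;
  in_control : nat -> nat -> nat ;
  in_bound : R ;
  in_eps : R ;
  in_m : nat ;
  in_n : nat }.

Section Semantics.
Variables (R : realType) (I : input R).

Fixpoint sem (a : ty) : Type :=
  match a with
  | TyNat => nat
  | TyNum => R[i]
  | TyArr a b => sem a -> sem b
  end.

Fixpoint env (G : seq ty) : Type :=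
  if G is a :: G' then (sem a * env G')%type else unit.

Fixpoint lookup (G : seq ty) (a : ty) (x : var G a) : env G -> sem a :=
  match x in var G a return env G -> sem a with
  | VarZ _ _ => fun r => r.1
  | VarS _ _ _ y => fun r => lookup y r.2
  end.

Definition prim_rec (X : Type) (x0 : X) (f : nat -> X -> X) : nat -> X :=
  fix loop k := if k is k'.+1 then f k' (loop k') else x0.

(* In R[i], [x <= y] means Im x = Im y and Re x <= Re y. *)
Fixpoint denote (G : seq ty) (a : ty) (t : tm G a) : env G -> sem a :=
  match t in tm _ a return env G -> sem a with
  | TmVar _ x => lookup x
  | TmLam _ _ b => fun r x => denote b (x, r)
  | TmApp _ _ f u => fun r => (denote f r) (denote u r)
  | TmZero => fun _ => 0%N
  | TmSucc => fun _ => S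
  | TmRec a => fun _ => @prim_rec (sem a)
  | TmOfNat => fun _ (k : nat) => k%:R : R[i]
  | TmAdd => fun _ (x y : R[i]) => x + y
  | TmOpp => fun _ (x : R[i]) => - x
  | TmMul => fun _ (x y : R[i]) => x * y
  | TmInv => fun _ (x : R[i]) => x^-1
  | TmConj => fun _ (x : R[i]) => x^*
  | TmLeq => fun _ (x y : R[i]) => nat_of_bool (x <= y)
  | TmEntry => fun _ => in_entry I
  | TmControl => fun _ => in_control I
  | TmBound => fun _ => (in_bound I)%:C%C
  | TmEps => fun _ => (in_eps I)%:C%C
  | TmParM => fun _ => in_m I
  | TmParN => fun _ => in_n I
  end.

End Semantics.

Record algorithm := Algorithm {
  halt_test : tm [::] (TyNat ~> TyNat) ;
  answer : tm [::] (TyNat ~> TyNat) }.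

(* The search stops at the first k at which the test is nonzero. *)
Definition outputs (R : realType) (p : algorithm) (I : input R) (j : nat) :
    Prop :=
  exists k, [/\ denote I (halt_test p) tt k <> 0%N,
                forall k', (k' < k)%N -> denote I (halt_test p) tt k' = 0%N
              & j = denote I (answer p) tt k].

(* the entry in row i and column k is <T e_k, e_i> *)
Definition operator_input (R : realType) (T : l2 R -> l2 R)
    (g : nat -> nat -> nat) (C epsilon : R) (m n : nat) : input R :=
  Input (fun i k => inner (T (ebasis R k)) (ebasis R i)) g C epsilon m n.

(* Main.v *)
(* If T^n = Q S is a QR decomposition, then the n-th IQR iterate of T is      *)
(* Q^* T Q, so that its (i, k) entry is <T q_k, q_i>, where the q_l are the   *)
(* Gram-Schmidt vectors of the columns T^n e_0, T^n e_1, ... The first m of   *)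
(* them depend on m columns only, and the columns of T^n and T_(j)^n differ   *)
(* by at most delta = n K^n / j with K = C + 1. Every Gram-Schmidt step       *)
(* multiplies such an error by at most 1 + 4 K^n / |u|, where u is the vector *)
(* projected out. The squares |u|^2 for T_(j) can be computed exactly,        *)
(* because T_(j)^n e_i has finite support, and they converge to nonzero       *)
(* limits; hence searching for a j whose error bound is at most epsilon       *)
(* succeeds. The Householder procedure gives the exact section of the iterate *)
(* of T_(j) because it produces orthonormal vectors in which the first        *)
(* columns are triangular with nonnegative diagonal, and such vectors are     *)
(* unique.                                                                    *)

Require Import Defs.
From mathcomp Require Import all_boot all_order all_algebra.
From mathcomp Require Import all_classical all_reals all_analysis.
From mathcomp Require Import complex.
From mathcomp Require Import ring lra.

Set Implicit Arguments.
Unset Strict Implicit.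
Unset Printing Implicit Defensive.
Import Order.TTheory GRing.Theory Num.Theory.
Import numFieldNormedType.Exports.
Local Open Scope classical_set_scope.
Local Open Scope ring_scope.

(** * The inner product of l^2 *)

(** An IQR iterate is a unitary conjugate of the operator: if [B^n = Q S] is a QR decomposition,
    then [Q B_n = B Q] ([iqr_product]), and the columns of [Q] are the Gram-Schmidt vectors of the
    columns of [B^n] ([qr_mgs]). Hence the leading [m x m] block of [B_n] depends only on [B] and on
    [m] Gram-Schmidt vectors ([iqr_entry]). Comparing [T] with [T_(j)] becomes a perturbation
    problem for [m] columns: those of [T^n] and [T_(j)^n] differ by [O(1/j)] ([iter_dist]), and
    Gram-Schmidt amplifies this by factors governed by the inverse norms of the pivots [mgs _ s s]
    ([mgs_dist], [gram_schmidt_dist]).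

    The choice of [j] is effective because this estimate can be run with the pivots of either
    operator in the denominators. With the pivots of [T_(j)] the error bound is computable
    ([iqr_section_dist]): the relevant columns of [T_(j)^n] have finite support, and only squared
    pivots occur, which are obtained from the Gram matrix by field operations. With the pivots of
    [T], for which no lower bound is given, one sees that the pivots of [T_(j)] stay away from 0 for
    large [j] ([iter_pivots_lower]), so that the computable bound drops below epsilon for some [j]
    ([test_eventually]). The program searches for the first such [j]; [denote_ttest] identifies its
    test with the real inequality.

    The finite procedure is exact by uniqueness: the Householder unitary yields orthonormal vectors
    in which the first columns are triangular with nonnegative diagonal, and by [mgs_unique] these
    are the Gram-Schmidt vectors ([householder_step_section]). Since an IQR step preserves the
    column control ([iqr_step_control]), induction on [n] gives [householder_iqr_section]. *)

Section ComplexSeries.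
Variable R : realType.
Local Notation normc := (@Normc.normc R).
Implicit Types (z w : nat -> R[i]) (a b : R[i]).

Lemma normc_ge0 a : 0 <= normc a.
Proof. by case: a => p q; exact: sqrtr_ge0. Qed.

Lemma norm_normc a : `|a| = (normc a)%:C%C.
Proof. by []. Qed.

Lemma mul_conjC a : a * a^* = (normc a ^+ 2)%:C%C.
Proof. by rewrite -normCK norm_normc -rmorphXn. Qed.

Lemma normc_conj a : normc a^* = normc a.
Proof. by apply: complexI; rewrite -!norm_normc norm_conjC. Qed.

Lemma normc_real_ge0 (c : R) : 0 <= c -> normc c%:C%C = c.
Proof. by move=> c0; apply: complexI; rewrite -norm_normc ger0_norm // ler0c. Qed.

Lemma conjC_real_complex (c : R) : c%:C%C^* = c%:C%C.
Proof. exact: conjc_real. Qed.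

Lemma normc_le_Re a : `|complex.Re a| <= normc a.
Proof. by rewrite -lecR; exact: normc_ge_Re. Qed.

Lemma normc_le_Im a : `|complex.Im a| <= normc a.
Proof.
have -> : complex.Im a = complex.Re (- 'i%C * a) by case: a => p q /=; ring.
apply: le_trans (normc_le_Re _) _.
by rewrite Normc.normcM normcN /= expr0n /= expr1n add0r sqrtr1 mul1r.
Qed.

Definition csummable z : Prop :=
  cvgn (series (fun k => complex.Re (z k))) /\
  cvgn (series (fun k => complex.Im (z k))).

(** Shaped so that [inner] unfolds to it; the algebra of [inner] is then linearity of this sum. *)
Definition csum z : R[i] :=
  Complex (limn (series (fun k => complex.Re (z k))))
          (limn (series (fun k => complex.Im (z k)))).

Lemma csummable_lin a z w : csummable z -> csummable w ->
  csummable (fun k => a * z k + w k) /\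
  csum (fun k => a * z k + w k) = a * csum z + csum w.
Proof.
move=> [zr zi] [wr wi]; case: a => p q; rewrite /csummable /csum.
have -> : (fun k => complex.Re (Complex p q * z k + w k)) =
   (p *: (fun k => complex.Re (z k))) - (q *: (fun k => complex.Im (z k)))
   + (fun k => complex.Re (w k)).
  by apply/funext => k; rewrite [RHS]/(p * _ - q * _ + _); case: (z k); case: (w k).
have -> : (fun k => complex.Im (Complex p q * z k + w k)) =
   (p *: (fun k => complex.Im (z k))) + (q *: (fun k => complex.Re (z k)))
   + (fun k => complex.Im (w k)).
  by apply/funext => k; rewrite [RHS]/(p * _ + q * _ + _); case: (z k); case: (w k).
have Z (c : R) u : cvgn (series u) -> cvgn (series (c *: u : R^nat)).
  exact: is_cvg_seriesZ.
have := (Z p _ zi, Z q _ zr, Z p _ zr, Z q _ zi) => -[[[pzi qzr] pzr] qzi].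
have czi := is_cvg_seriesD pzi qzr; have czr := is_cvg_seriesB pzr qzi.
split; first by split; apply: is_cvg_seriesD.
by rewrite (lim_seriesD czr wr) (lim_seriesD czi wi) (lim_seriesB pzr qzi)
  (lim_seriesD pzi qzr) !lim_seriesZ.
Qed.

Lemma csum_conj z : csummable z -> csum (fun k => (z k)^*) = (csum z)^*.
Proof.
move=> [zr zi]; rewrite /csum.
have -> : (fun k => complex.Re (z k)^*) = (fun k => complex.Re (z k)).
  by apply/funext => k; case: (z k).
have -> : (fun k => complex.Im (z k)^*) = - (fun k => complex.Im (z k)).
  by apply/funext => k /=; rewrite /GRing.opp /=; case: (z k).
by rewrite lim_seriesN.
Qed.

Lemma lim_series_finite (V : normedModType R) (u : V^nat) n :
  (forall k, (n <= k)%N -> u k = 0) ->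
  series u @ \oo --> \sum_(k < n) u k.
Proof.
move=> u0; apply: cvg_near_cst; exists n => // N /= nN.
rewrite /series /= (big_cat_nat _ nN) //= [X in _ + X]big_nat.
rewrite [X in _ + X]big1 ?addr0 ?big_mkord // => k /andP[nk _].
exact: u0.
Qed.

Lemma csum_finite z n : (forall k, (n <= k)%N -> z k = 0) ->
  csum z = \sum_(k < n) z k.
Proof.
move=> z0; rewrite /csum.
have zr0 k : (n <= k)%N -> complex.Re (z k) = 0 by move=> /z0 ->.
have zi0 k : (n <= k)%N -> complex.Im (z k) = 0 by move=> /z0 ->.
have /cvg_lim -> // := lim_series_finite (V := R^o) zr0.
have /cvg_lim -> // := lim_series_finite (V := R^o) zi0.
elim/big_ind3 : _ => // [[? ?] ? ? [? ?] ? ? /= |k _].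
  by move=> [-> ->] [-> ->].
by case: (z k).
Qed.

End ComplexSeries.

Arguments inner : simpl never.
Arguments norm2 : simpl never.
Arguments l2val : simpl never.
Arguments Normc.normc : simpl never.

(** * Inner product space structure, truncations and completeness of [l2] *)

Section Hilbert.
Variable R : realType.
Local Notation normc := (@Normc.normc R).
Implicit Types (x y z : l2 R) (a b : R[i]).

Lemma l2P x y : (forall k, x k = y k) -> x = y.
Proof. by move=> xy; apply: val_inj; apply/funext. Qed.

Lemma l2D x y k : (x + y : l2 R) k = x k + y k. Proof. by []. Qed.
Lemma l2Z a x k : (a *: x : l2 R) k = a * x k. Proof. by []. Qed.
Lemma l2N x k : (- x : l2 R) k = - x k. Proof. by []. Qed.
Lemma l20 k : (0 : l2 R) k = 0. Proof. by []. Qed.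

Lemma l2_sum (I : Type) (r : seq I) (P : pred I) (F : I -> l2 R) k :
  (\sum_(i <- r | P i) F i : l2 R) k = \sum_(i <- r | P i) F i k.
Proof. by elim/big_rec2: _ => // i u v _ <-. Qed.

Lemma l2_cvg x : cvgn (series (fun k => normc (x k) ^+ 2)).
Proof. by have /asboolP := l2_summable x. Qed.
Arguments l2_cvg : clear implicits.

Lemma inner_csummable x y : csummable (fun k => x k * (y k)^*).
Proof.
have H (f : R[i] -> R) : (forall c, `|f c| <= normc c) ->
    cvgn (series (fun k => f (x k * (y k)^*) : R^o)).
  move=> fle; apply: normed_cvg.
  apply: (@series_le_cvg _ _
    ((fun k => normc (x k) ^+ 2) + (fun k => normc (y k) ^+ 2))).
  - by move=> k; exact: normr_ge0.
  - by move=> k; rewrite /GRing.add /= addr_ge0 // sqr_ge0.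
  - move=> k; rewrite /GRing.add /=; apply: le_trans (fle _) _.
    rewrite Normc.normcM normc_conj.
    have := normc_ge0 (x k); have := normc_ge0 (y k).
    move: (normc (x k)) (normc (y k)) => p q; nra.
  - by apply: is_cvg_seriesD; exact: l2_cvg.
by split; apply: H; [exact: normc_le_Re|exact: normc_le_Im].
Qed.

Lemma innerE x y : inner x y = csum (fun k => x k * (y k)^*).
Proof. by []. Qed.

Lemma innerDZl a x y z : inner (a *: x + y) z = a * inner x z + inner y z.
Proof.
rewrite !innerE.
have [_ <-] := csummable_lin a (inner_csummable x z) (inner_csummable y z).
by congr csum; apply/funext => k; rewrite l2D l2Z mulrDl mulrA.
Qed.

Lemma innerC x y : inner y x = (inner x y)^*.
Proof.
rewrite !innerE -csum_conj; last exact: inner_csummable.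
by congr csum; apply/funext => k; rewrite rmorphM /= conjCK mulrC.
Qed.

Lemma innerDl x y z : inner (x + y) z = inner x z + inner y z.
Proof. by have := innerDZl 1 x y z; rewrite scale1r mul1r. Qed.
Lemma inner0l y : inner 0 y = 0.
Proof.
by have := innerDZl (-1) y y y; rewrite scaleN1r addNr mulN1r addNr.
Qed.
Lemma innerZl a x y : inner (a *: x) y = a * inner x y.
Proof. by have := innerDZl a x 0 y; rewrite addr0 inner0l addr0. Qed.
Lemma innerNl x y : inner (- x) y = - inner x y.
Proof. by rewrite -scaleN1r innerZl mulN1r. Qed.
Lemma innerBl x y z : inner (x - y) z = inner x z - inner y z.
Proof. by rewrite innerDl innerNl. Qed.
Lemma innerDr x y z : inner x (y + z) = inner x y + inner x z.
Proof. by rewrite ![inner x _]innerC innerDl rmorphD. Qed.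
Lemma inner0r x : inner x 0 = 0.
Proof. by rewrite innerC inner0l rmorph0. Qed.
Lemma innerZr a x y : inner x (a *: y) = a^* * inner x y.
Proof. by rewrite ![inner x _]innerC innerZl rmorphM. Qed.
Lemma innerNr x y : inner x (- y) = - inner x y.
Proof. by rewrite ![inner x _]innerC innerNl rmorphN. Qed.
Lemma innerBr x y z : inner x (y - z) = inner x y - inner x z.
Proof. by rewrite innerDr innerNr. Qed.

Lemma inner_suml (I : Type) (r : seq I) (P : pred I) (F : I -> l2 R) y :
  inner (\sum_(i <- r | P i) F i) y = \sum_(i <- r | P i) inner (F i) y.
Proof.
by elim/big_rec2: _ => [|i u v _ <-]; rewrite ?inner0l ?innerDl.
Qed.
Lemma inner_sumr (I : Type) (r : seq I) (P : pred I) (F : I -> l2 R) y :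
  inner y (\sum_(i <- r | P i) F i) = \sum_(i <- r | P i) inner y (F i).
Proof.
by elim/big_rec2: _ => [|i u v _ <-]; rewrite ?inner0r ?innerDr.
Qed.

Lemma norm2_ge0 x : 0 <= norm2 x. Proof. exact: sqrtr_ge0. Qed.

Lemma lim_norm2_ge0 x : 0 <= limn (series (fun k => normc (x k) ^+ 2)).
Proof.
apply: limr_ge; first exact: l2_cvg.
by apply: nearW => n; apply: sumr_ge0 => k _; exact: sqr_ge0.
Qed.

Lemma sqr_norm2 x : norm2 x ^+ 2 = limn (series (fun k => normc (x k) ^+ 2)).
Proof. by rewrite sqr_sqrtr // lim_norm2_ge0. Qed.

Lemma innerxx x : inner x x = (norm2 x ^+ 2)%:C%C.
Proof.
rewrite sqr_norm2 /inner.
have -> : (fun k => complex.Re (x k * (x k)^*)) = (fun k => normc (x k) ^+ 2).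
  by apply/funext => k; rewrite mul_conjC.
have -> : (fun k => complex.Im (x k * (x k)^*)) = (fun=> 0).
  by apply/funext => k; rewrite mul_conjC.
have /cvg_lim -> // := lim_series_finite (V := R^o) (u := fun=> 0) (n := 0) (fun _ _ => erefl).
by rewrite big_ord0.
Qed.

Lemma norm2_0 : norm2 (0 : l2 R) = 0.
Proof.
have := innerxx 0; rewrite inner0l => /esym/complexI/eqP.
by rewrite sqrf_eq0 => /eqP.
Qed.

Lemma sum_le_norm2 x n : \sum_(k < n) normc (x k) ^+ 2 <= norm2 x ^+ 2.
Proof.
rewrite sqr_norm2.
have := @nondecreasing_cvgn_le _ (series (fun k => normc (x k) ^+ 2)) _ (l2_cvg x) n.
rewrite /series /= big_mkord; apply.
apply/nondecreasing_seqP => k.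
by rewrite !big_mkord big_ord_recr /= lerDl sqr_ge0.
Qed.

Lemma normc_le_norm2 x k : normc (x k) <= norm2 x.
Proof.
rewrite -(@ler_pXn2r _ 2) // ?nnegrE ?normc_ge0 ?norm2_ge0 //.
apply: le_trans (sum_le_norm2 x k.+1); rewrite big_ord_recr /= lerDr.
by apply: sumr_ge0 => i _; exact: sqr_ge0.
Qed.

Lemma norm2_eq0 x : norm2 x = 0 -> x = 0.
Proof.
move=> x0; apply: l2P => k; apply: Normc.eq0_normc.
by apply: le_anti; rewrite normc_ge0 -{1}x0 normc_le_norm2.
Qed.

Lemma norm2_gt0 x : x != 0 -> 0 < norm2 x.
Proof.
move=> x0; rewrite lt0r norm2_ge0 andbT; apply: contra x0.
by move=> /eqP/norm2_eq0 ->.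
Qed.

Lemma norm2Z a x : norm2 (a *: x) = normc a * norm2 x.
Proof.
apply/eqP; rewrite -(@eqrXn2 _ 2) ?norm2_ge0 ?mulr_ge0 ?normc_ge0 ?norm2_ge0 //.
apply/eqP/complexI; rewrite -innerxx innerZl innerZr mulrA mul_conjC innerxx.
by rewrite -rmorphM exprMn.
Qed.

Lemma norm2N x : norm2 (- x) = norm2 x.
Proof. by rewrite -scaleN1r norm2Z normcN Normc.normc1 mul1r. Qed.

Lemma norm2_distC x y : norm2 (x - y) = norm2 (y - x).
Proof. by rewrite -norm2N opprB. Qed.

Lemma cauchy_schwarz x y : normc (inner x y) <= norm2 x * norm2 y.
Proof.
have [->|y0] := eqVneq y 0.
  by rewrite inner0r Normc.normc0 mulr_ge0 ?norm2_ge0.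
have ny := norm2_gt0 y0.
rewrite -(@ler_pXn2r _ 2) // ?nnegrE ?mulr_ge0 ?normc_ge0 ?norm2_ge0 //.
pose d : R[i] := (norm2 y ^+ 2)%:C%C.
have d0 : d != 0 by rewrite -[0]/(0%:C%C) (inj_eq (@complexI _)) sqrf_eq0 gt_eqF.
have dJ : d^* = d by exact: conjC_real_complex.
pose c : R[i] := inner x y / d.
have cJ : c^* = inner y x / d by rewrite /c fmorph_div /= dJ -innerC.
have : inner (x - c *: y) (x - c *: y) =
  (norm2 x ^+ 2 - normc (inner x y) ^+ 2 / norm2 y ^+ 2)%:C%C.
  rewrite innerBl !innerBr !innerZl !innerZr !innerxx -/d cJ mulfVK //.
  rewrite subrr subr0 rmorphB fmorph_div /= -/d -mul_conjC -innerC.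
  by congr (_ - _); rewrite mulrAC [inner y x * _]mulrC.
rewrite innerxx => /complexI E.
have : 0 <= norm2 x ^+ 2 - normc (inner x y) ^+ 2 / norm2 y ^+ 2.
  by rewrite -E sqr_ge0.
by rewrite subr_ge0 ler_pdivrMr ?exprn_gt0 // exprMn.
Qed.

Lemma norm2D x y : norm2 (x + y) <= norm2 x + norm2 y.
Proof.
rewrite -(@ler_pXn2r _ 2) // ?nnegrE ?addr_ge0 ?norm2_ge0 //.
have : norm2 (x + y) ^+ 2 =
    norm2 x ^+ 2 + norm2 y ^+ 2 + complex.Re (inner x y) *+ 2.
  apply: complexI; rewrite -innerxx innerDl !innerDr !innerxx.
  rewrite [inner y x]innerC mulr2n !rmorphD /=.
  have := addcJ (inner x y); rewrite mulr_natl mulr2n => <-.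
  by rewrite -[(_)^*%C]/(_^*); ring.
move=> ->; have := le_trans (ler_norm _) (normc_le_Re (inner x y)).
by have := cauchy_schwarz x y; rewrite -mulr_natl; lra.
Qed.

Lemma norm2_sum (I : Type) (r : seq I) (P : pred I) (F : I -> l2 R) :
  norm2 (\sum_(i <- r | P i) F i) <= \sum_(i <- r | P i) norm2 (F i).
Proof.
elim/big_rec2: _ => [|i u v _ h]; first by rewrite norm2_0.
by apply: le_trans (norm2D _ _) _; rewrite lerD2l.
Qed.

Lemma norm2B_le x y : norm2 x - norm2 y <= norm2 (x - y).
Proof.
rewrite lerBlDr; apply: le_trans (norm2D _ _).
by rewrite subrK.
Qed.

Lemma norm2_dist_triangle x y z : norm2 (x - z) <= norm2 (x - y) + norm2 (y - z).
Proof. by apply: le_trans (norm2D _ _); rewrite addrA subrK. Qed.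

Lemma norm2_dist_le x y : `|norm2 x - norm2 y| <= norm2 (x - y).
Proof.
rewrite ler_norml lerNl opprB norm2B_le andbT.
by rewrite norm2_distC norm2B_le.
Qed.

Lemma inner_ext x y : (forall z, inner x z = inner y z) -> x = y.
Proof.
move=> xy; apply/subr0_eq/norm2_eq0/eqP; rewrite -sqrf_eq0; apply/eqP/complexI.
by rewrite -innerxx {1}innerBl xy subrr.
Qed.

Lemma truncE n (u : nat -> R[i]^o) k : trunc n u k = if (k < n)%N then u k else 0.
Proof. by []. Qed.

Lemma inner_finiter x y n : (forall k, (n <= k)%N -> y k = 0) ->
  inner x y = \sum_(k < n) x k * (y k)^*.
Proof.
by move=> y0; rewrite innerE; apply: csum_finite => k /y0 ->; rewrite rmorph0 mulr0.
Qed.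

Lemma inner_truncr x y n : inner x (trunc n y) = \sum_(k < n) x k * (y k)^*.
Proof.
rewrite (@inner_finiter _ _ n); first by apply: eq_bigr => k _; rewrite truncE ltn_ord.
by move=> k; rewrite truncE ltnNge => ->.
Qed.

Lemma sqr_norm2_finite x n : (forall k, (n <= k)%N -> x k = 0) ->
  norm2 x ^+ 2 = \sum_(k < n) normc (x k) ^+ 2.
Proof.
move=> x0; apply: complexI; rewrite -innerxx (inner_finiter _ x0) rmorph_sum.
by apply: eq_bigr => k _; rewrite mul_conjC.
Qed.

Lemma ebasisE j k : ebasis R j k = (k == j)%:R.
Proof.
by rewrite truncE ltnS; case: eqP => [->|]; rewrite ?leqnn //; case: ifP.
Qed.

Lemma inner_ebasis x k : inner x (ebasis R k) = x k.
Proof.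
rewrite (@inner_finiter _ _ k.+1); last first.
  by move=> i ki; rewrite ebasisE gtn_eqF.
rewrite big_ord_recr /= ebasisE eqxx rmorph1 mulr1 big1 ?add0r // => i _.
by rewrite ebasisE ltn_eqF // rmorph0 mulr0.
Qed.

Lemma trunc_sum n x : trunc n x = \sum_(k < n) x k *: ebasis R k.
Proof.
apply: l2P => i; rewrite l2_sum truncE; case: ifPn => [lt_in|].
  rewrite (bigD1 (Ordinal lt_in)) //= l2Z ebasisE eqxx mulr1 big1 ?addr0 //.
  by move=> j /eqP/val_eqP /= ji; rewrite l2Z ebasisE eq_sym (negbTE ji) mulr0.
rewrite -leqNgt => le_ni; rewrite big1 // => j _.
by rewrite l2Z ebasisE gtn_eqF ?mulr0 // (leq_trans _ le_ni).
Qed.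

(** By Pythagoras the squared distance is the tail of the series of squared moduli. *)
Lemma trunc_cvg x : (fun n => norm2 (x - trunc n x)) @ \oo --> (0 : R).
Proof.
have E n : norm2 (x - trunc n x) ^+ 2 =
    norm2 x ^+ 2 - series (fun k => normc (x k) ^+ 2) n.
  apply: complexI; rewrite -innerxx innerBl !innerBr [inner (trunc n x) x]innerC.
  rewrite !inner_truncr rmorph_sum rmorphB innerxx /series /= big_mkord rmorph_sum.
  rewrite -[RHS]subr0; congr (_ - _ - _).
    by apply: eq_bigr => k _; rewrite mul_conjC.
  apply/eqP; rewrite subr_eq0; apply/eqP/eq_bigr => k _.
  by rewrite truncE ltn_ord rmorphM /= conjCK mulrC.
have sq0 : (fun n => norm2 (x - trunc n x) ^+ 2) @ \oo --> (0 : R).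
  under eq_cvg do rewrite E.
  have := cvgB (cvg_cst (norm2 x ^+ 2 : R^o)) (l2_cvg x).
  by rewrite -sqr_norm2 subrr; apply.
apply/cvgrPdist_lt => e e0.
have /cvgrPdist_lt/(_ (e ^+ 2)) := sq0.
move=> /(_ (exprn_gt0 _ e0)); apply: filterS => n.
rewrite !sub0r !normrN !ger0_norm ?sqr_ge0 ?norm2_ge0 //.
by rewrite ltr_pXn2r // ?nnegrE ?norm2_ge0 // ltW.
Qed.

(** The form in which completeness enters: operators into [l2] are built from their coordinates
    through this lemma. *)
Lemma bounded_partial_l2 (y : nat -> R[i]) (c : R) :
  (forall n, \sum_(k < n) normc (y k) ^+ 2 <= c ^+ 2) ->
  exists2 x : l2 R, x =1 y & 0 <= c -> norm2 x <= c.
Proof.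
move=> yc.
have ys : y \in @square_summable R.
  apply/asboolP; apply: nondecreasing_is_cvgn.
    apply/nondecreasing_seqP => k.
    by rewrite /series /= !big_mkord big_ord_recr /= lerDl sqr_ge0.
  by exists (c ^+ 2) => _ [n _ <-]; rewrite /series /= big_mkord.
exists (L2 ys) => // c0.
rewrite -(@ler_pXn2r _ 2) // ?nnegrE ?norm2_ge0 // sqr_norm2.
apply: limr_le; first exact: (l2_cvg (L2 ys)).
by apply: nearW => n; rewrite /series /= big_mkord; exact: yc.
Qed.

End Hilbert.

(** * Bounded operators *)

Section BoundedOperators.
Variable R : realType.
Local Notation normc := (@Normc.normc R).
Local Notation e_ := (ebasis R).
Implicit Types (x y z : l2 R) (a b : R[i]) (A B Q : l2 R -> l2 R).

Section LinearPredicate.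
Variable A : l2 R -> l2 R.
Hypothesis linA : linear A.

Lemma lin0 : A 0 = 0.
Proof. by have := linA (-1) 0 0; rewrite scaler0 addr0 scaleN1r addNr. Qed.
Lemma linD x y : A (x + y) = A x + A y.
Proof. by have := linA 1 x y; rewrite !scale1r. Qed.
Lemma linZ a x : A (a *: x) = a *: A x.
Proof. by have := linA a x 0; rewrite lin0 !addr0. Qed.
Lemma linN x : A (- x) = - A x.
Proof. by rewrite -scaleN1r linZ scaleN1r. Qed.
Lemma linB x y : A (x - y) = A x - A y.
Proof. by rewrite linD linN. Qed.
Lemma lin_sum (I : Type) (r : seq I) (P : pred I) (F : I -> l2 R) :
  A (\sum_(i <- r | P i) F i) = \sum_(i <- r | P i) A (F i).
Proof. by elim/big_rec2: _ => [|i u v _ <-]; rewrite ?lin0 ?linD. Qed.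
End LinearPredicate.

Lemma bounded_linear_bound A : bounded_linear A ->
  exists2 c : R, 0 <= c & forall x, norm2 (A x) <= c * norm2 x.
Proof.
move=> [_ [c Ac]]; exists `|c| => // x; apply: le_trans (Ac x) _.
by rewrite ler_wpM2r ?norm2_ge0 ?ler_norm.
Qed.

Lemma bounded_linear_comp A B :
  bounded_linear A -> bounded_linear B -> bounded_linear (A \o B).
Proof.
move=> bA bB; have [a a0 Aa] := bounded_linear_bound bA.
have [b b0 Bb] := bounded_linear_bound bB.
have [linA _] := bA; have [linB _] := bB.
split; first by move=> c x y /=; rewrite linB linA.
exists (a * b) => x /=; apply: le_trans (Aa _) _.
by rewrite -mulrA ler_wpM2l.
Qed.

Lemma bounded_linear_id : bounded_linear (@id (l2 R)).
Proof. by split=> //; exists 1 => x; rewrite mul1r. Qed.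

Lemma bounded_linearB A B : bounded_linear A -> bounded_linear B ->
  bounded_linear (fun x => A x - B x).
Proof.
move=> bA bB; have [a a0 Aa] := bounded_linear_bound bA.
have [b b0 Bb] := bounded_linear_bound bB.
have [linA _] := bA; have [linB _] := bB.
split; first by move=> c x y; rewrite linB linA scalerBr opprD addrACA.
exists (a + b) => x; apply: le_trans (norm2D _ _) _.
by rewrite norm2N mulrDl lerD.
Qed.

Lemma invertible_comp A B : invertible A -> invertible B -> invertible (A \o B).
Proof.
move=> [A' [bA' AK KA]] [B' [bB' BK KB]]; exists (B' \o A').
split; first exact: bounded_linear_comp.
- by move=> x /=; rewrite AK BK.
- by move=> x /=; rewrite KB KA.
Qed.

Lemma invertible_id : invertible (@id (l2 R)).
Proof. by exists id; split=> //; exact: bounded_linear_id. Qed.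

Lemma opnorm_le A (c : R) :
  (forall x, norm2 x <= 1 -> norm2 (A x) <= c) -> opnorm A <= c.
Proof.
move=> Ac; apply: ge_sup.
  by exists (norm2 (A 0)); exists 0 => //=; rewrite norm2_0.
by move=> _ [x x1 <-]; exact: Ac.
Qed.

Lemma le_opnorm A x : bounded_linear A -> norm2 (A x) <= opnorm A * norm2 x.
Proof.
move=> bA; have [c c0 Ac] := bounded_linear_bound bA.
have [linA _] := bA.
have [->|x0] := eqVneq x 0; first by rewrite lin0 // norm2_0 mulr0.
have nx := norm2_gt0 x0.
rewrite -ler_pdivrMr //.
have -> : norm2 (A x) / norm2 x = norm2 (A ((norm2 x)^-1%:C%C *: x)).
  rewrite linZ // norm2Z mulrC; congr (_ * _).
  by apply: complexI; rewrite -norm_normc ger0_norm // ler0c invr_ge0 norm2_ge0.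
apply: ub_le_sup.
  exists c => _ [y y1 <-]; apply: le_trans (Ac y) _.
  by rewrite ler_piMr.
exists ((norm2 x)^-1%:C%C *: x) => //=.
rewrite norm2Z (_ : normc _ = (norm2 x)^-1) ?mulVf ?gt_eqF //.
by apply: complexI; rewrite -norm_normc ger0_norm // ler0c invr_ge0 norm2_ge0.
Qed.

Lemma opnorm_ge0 A : bounded_linear A -> 0 <= opnorm A.
Proof.
move=> bA; have := le_opnorm (ebasis R 0) bA.
have -> : norm2 (ebasis R 0) = 1.
  apply/eqP; rewrite -(@eqrXn2 _ 2) ?norm2_ge0 //; apply/eqP/complexI.
  by rewrite -innerxx inner_ebasis ebasisE expr1n.
by rewrite mulr1; apply: le_trans (norm2_ge0 _).
Qed.

(** Finitely supported vectors are dense: [f x = f (x - trunc n x)], which tends to 0. *)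
Lemma functional_eq0 (f : l2 R -> R[i]) (c : R) :
  (forall a x y, f (a *: x + y) = a * f x + f y) ->
  (forall x, normc (f x) <= c * norm2 x) ->
  (forall k, f (e_ k) = 0) -> forall x, f x = 0.
Proof.
move=> linf fc fe x; apply: Normc.eq0_normc.
have f0 : f 0 = 0 by have := linf (-1) 0 0; rewrite scaler0 addr0 mulN1r addNr.
have ft n : f (trunc n x) = 0.
  rewrite trunc_sum; elim: n => [|n IH]; first by rewrite big_ord0.
  by rewrite big_ord_recr /= addrC linf fe mulr0 add0r.
have fE n : normc (f x) <= `|c| * norm2 (x - trunc n x).
  have -> : f x = f (x - trunc n x).
    by rewrite -scaleN1r addrC linf ft mulr0 add0r.
  apply: le_trans (fc _) _; apply: ler_wpM2r; [exact: norm2_ge0|exact: ler_norm].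
apply: le_anti; rewrite normc_ge0 andbT.
have H : (fun n => `|c| * norm2 (x - trunc n x)) @ \oo --> (0 : R).
  by have := cvgM (cvg_cst (`|c| : R^o)) (trunc_cvg x); rewrite mulr0; apply.
rewrite -(cvg_lim _ H) //; apply: limr_ge; first by apply/cvg_ex; exists 0.
by apply: nearW => n; exact: fE.
Qed.

Lemma operator_ext A B : bounded_linear A -> bounded_linear B ->
  (forall k, A (e_ k) = B (e_ k)) -> A = B.
Proof.
move=> bA bB AB; have bAB := bounded_linearB bA bB.
have [c c0 ABc] := bounded_linear_bound bAB.
apply/funext => x; apply/subr0_eq/l2P => k.
apply: (@functional_eq0 (fun x => (A x - B x) k) c).
- by move=> a y z; have [-> _] := bAB.
- by move=> y; apply: le_trans (normc_le_norm2 _ _) (ABc y).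
- by move=> i; rewrite AB subrr.
Qed.

(** Duality between synthesis and analysis: if [z] is the truncated coefficient sequence of [y],
    then [norm2 z ^+ 2] is the inner product of [y] with the sum of the [z k *: u k], hence at most
    [c * norm2 y * norm2 z]. Used for adjoints and, with orthonormal [u], for the inverse of the
    unitary QR factor. *)
Lemma bessel_operator (u : nat -> l2 R) (c : R) : 0 <= c ->
  (forall n y, norm2 (\sum_(k < n) y k *: u k) <= c * norm2 (trunc n y)) ->
  exists2 V, bounded_linear V & forall y k, V y k = inner y (u k).
Proof.
move=> c0 uc.
have partial y n :
    \sum_(k < n) normc (inner y (u k)) ^+ 2 <= (c * norm2 y) ^+ 2.
  pose z := trunc n (fun k => inner y (u k)).
  set S := \sum_(k < n) _.
  have SE : S = norm2 z ^+ 2.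
    rewrite (@sqr_norm2_finite _ z n); last by move=> k; rewrite /z truncE ltnNge => ->.
    by apply: eq_bigr => k _; rewrite /z truncE ltn_ord.
  have : inner y (\sum_(k < n) z k *: u k) = S%:C%C.
    rewrite inner_sumr rmorph_sum; apply: eq_bigr => k _.
    by rewrite innerZr /z truncE ltn_ord mulrC mul_conjC.
  have z_trunc : trunc n z = z by apply: l2P => k; rewrite /z !truncE; case: (k < n)%N.
  move=> yS; have := cauchy_schwarz y (\sum_(k < n) z k *: u k); rewrite yS.
  have -> : normc S%:C%C = S.
    by apply: complexI; rewrite -norm_normc ger0_norm // ler0c SE sqr_ge0.
  have := uc n z; rewrite z_trunc SE.
  move: (norm2_ge0 z) (norm2_ge0 y); move: (norm2 z) (norm2 y) => p q p0 q0.
  move: (norm2 _) => t tp pq.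
  have {}pq : p ^+ 2 <= (c * q) * p.
    by apply: le_trans pq _; rewrite [c * q]mulrC -mulrA ler_wpM2l.
  have [->|p1] := eqVneq p 0; first by rewrite expr0n sqr_ge0.
  rewrite ler_pXn2r ?nnegrE ?mulr_ge0 //.
  by rewrite -(@ler_pM2r _ p) -?expr2 // lt0r p1.
have /choice[V VE] : forall y, exists x : l2 R,
    (x =1 fun k => inner y (u k)) /\ norm2 x <= c * norm2 y.
  move=> y; have [x xE xc] := @bounded_partial_l2 _ (fun k => inner y (u k)) _ (partial y).
  by exists x; split=> //; apply: xc; rewrite mulr_ge0 ?norm2_ge0.
exists V; last by move=> y k; have [-> _] := VE y.
split; last by exists c => x; have [_] := VE x.
move=> a x y; apply: l2P => k; rewrite l2D l2Z.
have [-> _] := VE x; have [-> _] := VE y; have [-> _] := VE (a *: x + y).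
exact: innerDZl.
Qed.

(** The coordinates of [A' y] must be [inner y (A (e_ k))], and [bessel_operator] says that they are
    square summable; density extends the identity from basis vectors to all [x]. *)
Lemma adjoint_exists A : bounded_linear A ->
  exists2 A', bounded_linear A' & forall x y, inner (A x) y = inner x (A' y).
Proof.
move=> bA; have [c c0 Ac] := bounded_linear_bound bA; have [linA _] := bA.
have [n y|A' bA' A'E] := @bessel_operator (fun k => A (e_ k)) c c0.
  rewrite (eq_bigr (fun k : 'I_n => A (y k *: e_ k))); last first.
    by move=> k _; rewrite linZ.
  by rewrite -lin_sum // -trunc_sum; exact: Ac.
exists A' => // x y; apply/eqP; rewrite -subr_eq0; apply/eqP.
apply: (@functional_eq0 (fun x => inner (A x) y - inner x (A' y))
  (c * norm2 y + norm2 (A' y))).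
- move=> a z t; rewrite linA !innerDZl; ring.
- move=> z; apply: le_trans (le_normcD _ _) _; rewrite normcN mulrDl.
  apply: lerD; last by rewrite mulrC cauchy_schwarz.
  apply: le_trans (cauchy_schwarz _ _) _; rewrite mulrAC.
  by rewrite ler_wpM2r ?norm2_ge0.
- move=> k; rewrite [inner (e_ k) _]innerC inner_ebasis A'E -innerC.
  by rewrite subrr.
Qed.

Lemma ebasis_orthonormal i j : inner (e_ i) (e_ j) = (i == j)%:R.
Proof. by rewrite inner_ebasis ebasisE eq_sym. Qed.

Lemma unitary_norm2 Q x : unitary Q -> norm2 (Q x) = norm2 x.
Proof.
move=> [_ Qi _]; apply/eqP; rewrite -(@eqrXn2 _ 2) ?norm2_ge0 //.
by apply/eqP/complexI; rewrite -!innerxx Qi.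
Qed.

Lemma unitary_bounded Q : unitary Q -> bounded_linear Q.
Proof.
move=> uQ; have [linQ _ _] := uQ; split=> //; exists 1 => x.
by rewrite unitary_norm2 // mul1r.
Qed.

Lemma unitary_inj Q : unitary Q -> injective Q.
Proof.
move=> uQ x y Qxy; apply/subr0_eq/norm2_eq0.
have [linQ _ _] := uQ.
by rewrite -(unitary_norm2 _ uQ) linB // Qxy subrr norm2_0.
Qed.

Lemma unitary_invertible Q : unitary Q -> invertible Q.
Proof.
move=> uQ; have [linQ _ /choice[Q' QK]] := uQ; have injQ := unitary_inj uQ.
have KQ : cancel Q Q' by move=> x; apply: injQ; rewrite QK.
exists Q'; split=> //; split.
  by move=> a x y; apply: injQ; rewrite QK linQ !QK.
by exists 1 => x; rewrite mul1r -{2}(QK x) (unitary_norm2 _ uQ).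
Qed.

Lemma unitary_comp Q Q' : unitary Q -> unitary Q' -> unitary (Q \o Q').
Proof.
move=> [lQ iQ sQ] [lQ' iQ' sQ']; split.
- by move=> a x y /=; rewrite lQ' lQ.
- by move=> x y /=; rewrite iQ.
- by move=> y; have [z <-] := sQ y; have [x <-] := sQ' z; exists x.
Qed.

Lemma unitary_id : unitary (@id (l2 R)).
Proof. by split=> // y; exists y. Qed.

End BoundedOperators.

(** * Gram-Schmidt and the QR decomposition *)

Section GramSchmidt.
Variable R : realType.
Local Notation normc := (@Normc.normc R).
Local Notation e_ := (ebasis R).
Implicit Types (x y z : l2 R) (a b : R[i]) (v q : nat -> l2 R).

Definition normalize x : l2 R := (norm2 x)^-1%:C%C *: x.

(** For [u = 0] the quotient is 0 and the result is [x], so that orthogonality and contraction hold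
    for every [u]. *)
Definition reject u x : l2 R := x - (inner x u / inner u u) *: u.

(* Modified Gram-Schmidt without normalization: [mgs v s i] is the component *)
(* of [v i] orthogonal to [v 0], ..., [v s.-1].                               *)
Fixpoint mgs v (s : nat) : nat -> l2 R :=
  if s is s'.+1 then fun i => reject (mgs v s' s') (mgs v s' i) else v.

Lemma norm2_normalize x : x != 0 -> norm2 (normalize x) = 1.
Proof.
move=> x0; rewrite norm2Z normc_real_ge0 ?invr_ge0 ?norm2_ge0 //.
by rewrite mulVf // gt_eqF // norm2_gt0.
Qed.

Lemma normalizeK x : (norm2 x)%:C%C *: normalize x = x.
Proof.
rewrite scalerA -rmorphM; have [->|x0] := eqVneq x 0; first by rewrite scaler0.
by rewrite mulfV ?gt_eqF ?norm2_gt0 // scale1r.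
Qed.

Lemma innerxx_eq0 x : (inner x x == 0) = (x == 0).
Proof.
apply/eqP/eqP => [|->]; last exact: inner0l.
rewrite innerxx => /complexI/eqP; rewrite sqrf_eq0 => /eqP; exact: norm2_eq0.
Qed.

Lemma inner_reject u x y : inner x u = 0 -> inner (reject u y) x = inner y x.
Proof. by move=> xu; rewrite innerBl innerZl (innerC x u) xu rmorph0 mulr0 subr0. Qed.

Lemma reject_orth u x : inner (reject u x) u = 0.
Proof.
rewrite innerBl innerZl; have [->|u0] := eqVneq u 0; first by rewrite !inner0r mulr0 subr0.
by rewrite divfK ?subrr // innerxx_eq0.
Qed.

Lemma reject_normalize u x :
  reject u x = x - inner x (normalize u) *: normalize u.
Proof.
congr (_ - _); rewrite innerZr scalerA; congr (_ *: _).
rewrite conjC_real_complex innerxx rmorphXn /= expr2 invfM !fmorphV /=; ring.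
Qed.

Lemma mgs_orth v s k i : (k < s)%N -> inner (mgs v s i) (mgs v k k) = 0.
Proof.
elim: s k i => // s IH k i; rewrite ltnS leq_eqVlt => /predU1P[->|ks].
  exact: reject_orth.
by rewrite inner_reject; [exact: IH|rewrite innerC IH // rmorph0].
Qed.

Lemma mgs_expand v s i :
  v i = mgs v s i + \sum_(k < s) inner (mgs v k i) (normalize (mgs v k k))
                               *: normalize (mgs v k k).
Proof.
elim: s => [|s {1}->]; first by rewrite big_ord0 addr0.
by rewrite big_ord_recr /= reject_normalize addrA addrAC subrK.
Qed.

Definition orthonormal_upto m q :=
  forall i j, (i < m)%N -> (j < m)%N -> inner (q i) (q j) = (i == j)%:R.

Lemma orthonormal_norm2 m q (c : nat -> R[i]) : orthonormal_upto m q ->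
  norm2 (\sum_(k < m) c k *: q k) ^+ 2 = \sum_(k < m) normc (c k) ^+ 2.
Proof.
move=> oq; apply: complexI; rewrite -innerxx inner_suml rmorph_sum.
apply: eq_bigr => i _; rewrite inner_sumr (bigD1 i) //= innerZl innerZr oq //.
rewrite eqxx mulr1 mul_conjC big1 ?addr0 // => j /eqP ji.
rewrite innerZl innerZr oq // (_ : _ == _ = false) ?mulr0 //.
by apply/eqP => /val_inj ij; exact: ji.
Qed.

Lemma mgs_orthonormal v m : (forall i, (i < m)%N -> mgs v i i != 0) ->
  orthonormal_upto m (fun i => normalize (mgs v i i)).
Proof.
move=> v0 i j im jm; case: (ltngtP i j) => [ij|ji|->].
- by rewrite innerC innerZl innerZr mgs_orth // !mulr0 rmorph0.
- by rewrite innerZl innerZr mgs_orth // !mulr0.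
- by rewrite innerxx norm2_normalize ?v0 // expr1n.
Qed.

(** By [mgs_expand], [v j] lies in the span of the first [j + 1] orthonormal vectors. This gives
    triangularity and the positive diagonal of the QR factor. *)
Lemma mgs_coef v j i : (forall i, mgs v i i != 0) -> (j <= i)%N ->
  inner (v j) (normalize (mgs v i i)) = (norm2 (mgs v j j))%:C%C * (j == i)%:R.
Proof.
move=> u0 ji; have oq := @mgs_orthonormal v i.+1 (fun i _ => u0 i).
rewrite {1}(mgs_expand v j j) -{1}[mgs v j j]normalizeK innerDl innerZl oq // inner_suml.
rewrite big1 ?addr0 // => k _; have ki := leq_trans (ltn_ord k) ji.
by rewrite innerZl oq ?ltnS ?(ltnW ki) // ltn_eqF // mulr0.
Qed.

(* [mgs v i i != 0] is what is known for the Householder factors, and         *)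
(* [r i i != 0] for a QR decomposition.                                       *)
Lemma mgs_unique m v q (r : nat -> nat -> R[i]) :
  orthonormal_upto m q ->
  (forall i, (i < m)%N -> v i = \sum_(k < i.+1) r k i *: q k) ->
  (forall i, (i < m)%N -> 0 <= r i i) ->
  (forall i, (i < m)%N -> mgs v i i != 0 \/ r i i != 0) ->
  forall i, (i < m)%N -> mgs v i i != 0 /\ q i = normalize (mgs v i i).
Proof.
move=> oq vE r_ge0 nz.
(* Invariant: after [s] rejections exactly the terms with [k >= s] of the triangular expansion are
   left. The diagonal term alone remains at [s = i]. *)
have mgsE s i : (s <= i < m)%N -> mgs v s i = \sum_(s <= k < i.+1) r k i *: q k.
  elim: s i => [|s IH] i; first by move=> im; rewrite big_mkord /= vE.
  case/andP=> si im /=.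
  have sm : (s < m)%N by exact: ltn_trans im.
  rewrite !IH ?leqnn ?sm // ?(ltnW si) // big_nat1.
  have rss0 : r s s != 0.
    have [|//] := nz s sm; rewrite IH ?leqnn // big_nat1.
    by apply: contra => /eqP ->; rewrite scale0r.
  have num : inner (\sum_(s <= k < i.+1) r k i *: q k) (r s s *: q s) = r s i * (r s s)^*.
    rewrite big_ltn ?ltnS ?(ltnW si) // innerDl innerZl innerZr oq // eqxx mulr1.
    rewrite inner_suml big_nat big1 ?addr0 // => k /andP[sk ki].
    rewrite innerZl innerZr oq //; last exact: leq_trans im.
    by rewrite gtn_eqF // !mulr0.
  rewrite /reject num innerZl innerZr oq // eqxx mulr1 scalerA.
  rewrite -mulf_div mulrAC mulfVK // divff ?conjC_eq0 // mulr1.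
  by rewrite [in LHS]big_ltn ?ltnS ?(ltnW si) // addrC addKr.
move=> i im; have E := mgsE i i; rewrite leqnn im big_nat1 in E.
have rii0 : r i i != 0.
  have [|//] := nz i im; rewrite E //.
  by apply: contra => /eqP ->; rewrite scale0r.
have nq : norm2 (q i) = 1.
  apply/eqP; rewrite -(@eqrXn2 _ 2) ?norm2_ge0 //; apply/eqP/complexI.
  by rewrite -innerxx oq // eqxx expr1n.
rewrite E //; split.
  apply: contra rii0; rewrite -innerxx_eq0 innerxx norm2Z nq mulr1.
  by rewrite rmorphXn /= -norm_normc expf_eq0 /= normr_eq0.
rewrite /normalize norm2Z nq mulr1 scalerA fmorphV /= -norm_normc ger0_norm ?r_ge0 //.
by rewrite mulVf // scale1r.
Qed.

(** Step [s] only subtracts multiples of images of vectors supported on coordinates up to [s], so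
    later coordinates of the preimage stay those of [e_ i]. This yields nonzero pivots for injective
    [B], and a support bound for the columns of [Q]. *)
Lemma mgs_image B s i : linear B ->
  exists2 x, mgs (fun k => B (e_ k)) s i = B x
    & forall k, (s <= k)%N -> (x : l2 R) k = (k == i)%:R.
Proof.
move=> lB; move: i; set v := fun k => _.
elim: s => [|s IH] i; first by exists (e_ i) => // k _; rewrite ebasisE.
have [x xE xk] := IH i; have [y yE yk] := IH s.
pose c := inner (B x) (B y) / inner (B y) (B y).
exists (x - c *: y).
  by rewrite /= /reject xE yE -/c (linB lB) (linZ lB).
move=> k sk; rewrite l2D l2N l2Z xk ?yk 1?ltnW //.
by rewrite (gtn_eqF sk) mulr0 subr0.
Qed.

Lemma mgs_injective B s : linear B -> injective B ->
  mgs (fun k => B (e_ k)) s s != 0.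
Proof.
move=> lB injB; have [x -> xk] := mgs_image s s lB; apply/eqP => Bx0.
have x0 : x = 0 by apply: injB; rewrite Bx0 lin0.
by have := xk s (leqnn s); rewrite x0 eqxx => /eqP; rewrite eq_sym oner_eq0.
Qed.

End GramSchmidt.

(** * Existence and uniqueness of QR, and IQR iterates as unitary conjugates *)

Section QRDecomposition.
Variable R : realType.
Local Notation normc := (@Normc.normc R).
Local Notation e_ := (ebasis R).
Implicit Types (x y z : l2 R) (B Q S : l2 R -> l2 R).

Lemma invertible_inj B : invertible B -> injective B.
Proof. by move=> [B' [_ BK _]]; exact: can_inj BK. Qed.

(** [V] is the analysis operator of the Gram-Schmidt vectors [q] and [W] its adjoint, with
    [W (e_ k) = q k]. The factors are [W] and [V \o B]. *)
Lemma qr_exists B : bounded_linear B -> invertible B ->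
  exists Q S, is_QR B Q S.
Proof.
move=> bB iB; have [linB _] := bB; have injB := invertible_inj iB.
pose v k := B (e_ k); pose q i := normalize (mgs v i i).
have u0 i : mgs v i i != 0 by exact: mgs_injective.
have oq m : orthonormal_upto m q by apply: mgs_orthonormal => i _; exact: u0.
have [n y|V bV VE] := @bessel_operator _ q 1 ler01.
  rewrite mul1r -(@ler_pXn2r _ 2) // ?nnegrE ?norm2_ge0 // orthonormal_norm2 //.
  rewrite (@sqr_norm2_finite _ (trunc n y) n) => [|k]; last by rewrite truncE ltnNge => ->.
  by apply: ler_sum => k _; rewrite truncE ltn_ord.
have [linV _] := bV.
have Vq k : V (q k) = e_ k.
  apply: l2P => i; rewrite VE ebasisE (oq (maxn i k).+1) ?ltnS ?leq_maxl ?leq_maxr //.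
  by rewrite eq_sym.
have [W bW VW] := adjoint_exists bV; have [linW _] := bW.
have We k : W (e_ k) = q k.
  by apply: inner_ext => z; rewrite innerC -VW inner_ebasis VE -innerC.
have VWK : V \o W = id.
  apply: operator_ext; [exact: bounded_linear_comp|exact: bounded_linear_id|].
  by move=> k /=; rewrite We Vq.
have WVB : W \o V \o B = B.
  apply: operator_ext => //; first exact: bounded_linear_comp (bounded_linear_comp bW bV) bB.
  move=> k /=; rewrite -/(v k) (mgs_expand v k k).
  rewrite -[mgs v k k]normalizeK -/(q k).
  have WVq a i : W (V (a *: q i)) = a *: q i by rewrite (linZ linV) (linZ linW) Vq We.
  by rewrite (linD linV) (linD linW) (lin_sum linV) (lin_sum linW) WVq; congr (_ + _); apply: eq_bigr => i _; exact: WVq.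
have [B' [bB' BK KB]] := iB.
(* Surjectivity of [B] turns [W \o V \o B = B] into [W \o V = id]: the vectors [q] are complete. *)
have WVK y : W (V y) = y by have := congr1 (@^~ (B' y)) WVB; rewrite /= KB.
have VWx x : V (W x) = x by exact: (congr1 (@^~ x) VWK).
have SE i j : inner (V (B (e_ j))) (e_ i) = inner (v j) (q i).
  by rewrite inner_ebasis VE.
exists W, (V \o B); split; first by rewrite compA WVB.
  split=> //; last by move=> y; exists (V y).
  by move=> x y; rewrite -VW VWx.
split; first exact: bounded_linear_comp.
- exists (B' \o W); split; first exact: bounded_linear_comp.
  + by move=> x /=; rewrite WVK BK.
  + by move=> x /=; rewrite KB VWx.
- move=> i j ji; rewrite [LHS]SE mgs_coef ?(ltnW ji) //.
  by rewrite ltn_eqF // mulr0.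
- move=> j; rewrite [inner _ _]SE mgs_coef // eqxx mulr1.
  by rewrite ltcR norm2_gt0.
Qed.

Lemma qr_columns B Q S : is_QR B Q S ->
  [/\ forall m, orthonormal_upto m (fun k => Q (e_ k)),
      forall i, B (e_ i) = \sum_(k < i.+1) (S (e_ i) : l2 R) k *: Q (e_ k)
    & forall i, 0 < (S (e_ i) : l2 R) i].
Proof.
move=> [BE [linQ iQ _] [_ _ tS pS]]; split.
- by move=> m i j _ _; rewrite iQ ebasis_orthonormal.
- move=> i; have -> : B (e_ i) = Q (S (e_ i)) by rewrite BE.
  have {1}-> : S (e_ i) = trunc i.+1 (S (e_ i)).
    apply: l2P => k; rewrite truncE; case: ltnP => // ik.
    by rewrite -inner_ebasis tS.
  by rewrite trunc_sum (lin_sum linQ); apply: eq_bigr => k _; rewrite (linZ linQ).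
- by move=> i; rewrite -inner_ebasis.
Qed.

Lemma qr_mgs B Q S : is_QR B Q S -> forall k,
  Q (e_ k) = normalize (mgs (fun i => B (e_ i)) k k).
Proof.
move=> qr k; have [oq BE S0] := qr_columns qr.
have [] := @mgs_unique _ k.+1 (fun i => B (e_ i)) (fun i => Q (e_ i))
  (fun k i => (S (e_ i) : l2 R) k) _ _ _ _ k.
- exact: oq.
- by move=> i _; exact: BE.
- by move=> i _; exact: ltW.
- by move=> i _; right; rewrite gt_eqF.
- exact: ltnSn.
- by [].
Qed.

(** Existence of a QR decomposition guarantees that [xget] does not return its default value. *)
Lemma iqr_stepE B : bounded_linear B -> invertible B ->
  exists Q S, is_QR B Q S /\ iqr_step B = S \o Q.
Proof.
move=> bB iB; have [Q [S qr]] := qr_exists bB iB.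
have [Q' [S' [qr' E]]] : exists Q S, is_QR B Q S /\ iqr_step B = S \o Q.
  rewrite /iqr_step; set P := [set B' | _].
  by have : P (xget B P) by apply: (@xgetI _ B P (S \o Q)); exists Q, S.
by exists Q', S'.
Qed.

Lemma iqr_step_bounded B : bounded_linear B -> invertible B ->
  bounded_linear (iqr_step B) /\ invertible (iqr_step B).
Proof.
move=> bB iB; have [Q [S [[_ uQ [bS iS _ _]] ->]]] := iqr_stepE bB iB.
split; first exact: bounded_linear_comp bS (unitary_bounded uQ).
exact: invertible_comp iS (unitary_invertible uQ).
Qed.

Lemma iqr_bounded B n : bounded_linear B -> invertible B ->
  bounded_linear (iqr n B) /\ invertible (iqr n B).
Proof. by move=> bB iB; elim: n => //= n [b i]; exact: iqr_step_bounded. Qed.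

Lemma iter_bounded B n : bounded_linear B -> bounded_linear (iter n B).
Proof.
move=> bB; elim: n => [|n IH]; first exact: bounded_linear_id.
exact: bounded_linear_comp bB IH.
Qed.

Lemma upper_triangular_comp S S' : bounded_linear S -> bounded_linear S' ->
  upper_triangular S -> upper_triangular S' ->
  positive_diagonal S -> positive_diagonal S' ->
  upper_triangular (S \o S') /\ positive_diagonal (S \o S').
Proof.
move=> [linS _] _ tS tS' pS pS'.
have E j : S (S' (e_ j)) = \sum_(k < j.+1) (S' (e_ j) : l2 R) k *: S (e_ k).
  have {1}-> : S' (e_ j) = trunc j.+1 (S' (e_ j)).
    apply: l2P => k; rewrite truncE; case: ltnP => // ik.
    by rewrite -inner_ebasis tS'.
  by rewrite trunc_sum (lin_sum linS); apply: eq_bigr => k _; rewrite (linZ linS).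
split=> [i j ji|j] /=; rewrite E inner_suml.
  rewrite big1 // => k _; rewrite innerZl tS ?mulr0 //.
  by rewrite (leq_ltn_trans _ ji) // -ltnS ltn_ord.
rewrite big_ord_recr /= big1 ?add0r; last by move=> k _; rewrite innerZl tS ?mulr0.
by rewrite innerZl mulr_gt0 // -inner_ebasis.
Qed.

(** Induction: if [B^n = Q S], [Q B_n = B Q] and [B_n = Q1 S1], then [B^(n+1) = B Q S = Q B_n S = (Q
    Q1) (S1 S)], and [Q Q1] conjugates [B] to [S1 Q1]. *)
Lemma iqr_product B n : bounded_linear B -> invertible B ->
  exists Q S, is_QR (iter n B) Q S /\ forall x, Q (iqr n B x) = B (Q x).
Proof.
move=> bB iB; elim: n => [|n [Q [S [[E uQ [bS iS tS pS]] QB]]]].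
  exists id, id; split=> //; split=> //; first exact: unitary_id.
  split; [exact: bounded_linear_id|exact: invertible_id| |].
    by move=> i j ji; rewrite ebasis_orthonormal ltn_eqF.
  by move=> j; rewrite ebasis_orthonormal eqxx ltr01.
have [bn i_n] := iqr_bounded n bB iB.
have [Q1 [S1 [[E1 uQ1 [bS1 iS1 tS1 pS1]] E2]]] := iqr_stepE bn i_n.
have E1' x : iqr n B x = Q1 (S1 x) by rewrite {1}E1.
exists (Q \o Q1), (S1 \o S); split; last first.
  by move=> x /=; rewrite -[iqr_step _ _]/(iqr_step (iqr n B) x) E2 /= -E1' QB.
split; first by apply/funext => x /=; rewrite E /= -QB E1'.
  exact: unitary_comp.
have [t p] := upper_triangular_comp bS1 bS tS1 tS pS1 pS.
by split=> //; [exact: bounded_linear_comp|exact: invertible_comp].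
Qed.

Lemma iqr_entry B n i k : bounded_linear B -> invertible B ->
  let q l := normalize (mgs (fun l => iter n B (e_ l)) l l) in
  inner (iqr n B (e_ k)) (e_ i) = inner (B (q k)) (q i).
Proof.
move=> bB iB; have [Q [S [qr QB]]] := iqr_product n bB iB.
have [_ [_ iQ _] _] := qr.
by rewrite /= -!(qr_mgs qr) -QB iQ.
Qed.

End QRDecomposition.

(** * Perturbation bounds *)

Section Perturbation.
Variable R : realType.
Local Notation normc := (@Normc.normc R).
Local Notation e_ := (ebasis R).
Implicit Types (x y z u : l2 R) (a b : R[i]) (v w q : nat -> l2 R).

Lemma norm2_normalize_le1 x : norm2 (normalize x) <= 1.
Proof.
have [->|x0] := eqVneq x 0; last by rewrite norm2_normalize.
by rewrite /normalize scaler0 norm2_0.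
Qed.

Lemma norm2_reject u x : norm2 (reject u x) <= norm2 x.
Proof.
have [->|r0] := eqVneq (reject u x) 0; first by rewrite norm2_0 norm2_ge0.
have E : inner (reject u x) (reject u x) = inner (reject u x) x.
  by rewrite {2}/reject innerBr innerZr reject_orth mulr0 subr0.
have := cauchy_schwarz (reject u x) x.
rewrite -E innerxx normc_real_ge0 ?sqr_ge0 // expr2.
by rewrite ler_pM2l // norm2_gt0.
Qed.

Lemma norm2_mgs v s i : norm2 (mgs v s i) <= norm2 (v i).
Proof. by elim: s => //= s; apply: le_trans (norm2_reject _ _). Qed.

Lemma rejectB u x y : reject u (x - y) = reject u x - reject u y.
Proof.
by rewrite /reject innerBl mulrBl scalerBl !opprD !opprK addrACA.
Qed.

(** The factor 2 counts the error of the vector and that of its norm. Only [u'] must be nonzero, so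
    only one of the two families needs controlled pivots. *)
Lemma normalize_dist u u' : u' != 0 ->
  norm2 (normalize u - normalize u') <= 2 * norm2 (u - u') / norm2 u'.
Proof.
move=> u0; rewrite ler_pdivlMr ?norm2_gt0 // mulrC.
rewrite -{1}(normc_real_ge0 (norm2_ge0 u')) -norm2Z scalerBr normalizeK.
have -> : (norm2 u')%:C%C *: normalize u - u' =
    (norm2 u' - norm2 u)%:C%C *: normalize u + (u - u').
  by rewrite rmorphB scalerBl normalizeK addrA subrK.
apply: le_trans (norm2D _ _) _; rewrite mulrDl mul1r lerD2r norm2Z.
have -> : normc (norm2 u' - norm2 u)%:C%C = `|norm2 u' - norm2 u|.
  by apply: complexI; rewrite -norm_normc normc_def /= expr0n addr0 sqrtr_sqr.
apply: le_trans (_ : `|norm2 u' - norm2 u| * 1 <= _).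
  by rewrite ler_wpM2l // norm2_normalize_le1.
by rewrite mulr1 norm2_distC norm2_dist_le.
Qed.

(** The normalized [u] occurs twice in a rejection, as direction and inside the coefficient; each
    occurrence costs the factor 2 of [normalize_dist], whence 4. *)
Lemma reject_dist u u' x x' : u' != 0 ->
  norm2 (reject u x - reject u' x') <=
  norm2 (x - x') + norm2 x' * (4 * norm2 (u - u') / norm2 u').
Proof.
move=> u0; apply: le_trans (norm2_dist_triangle _ (reject u x') _) _.
apply: lerD; first by rewrite -rejectB norm2_reject.
rewrite !reject_normalize opprB [x' - _ + _]addrC addrA subrK.
set a := normalize u; set a' := normalize u'.
have -> : inner x' a' *: a' - inner x' a *: a =
    inner x' a' *: (a' - a) + inner x' (a' - a) *: a.
  by rewrite scalerBr innerBr scalerBl addrA subrK.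
have na : norm2 (a' - a) <= 2 * norm2 (u - u') / norm2 u'.
  by rewrite norm2_distC; exact: normalize_dist.
have le1 y z t : norm2 t <= 1 -> normc (inner y z) * norm2 t <= norm2 y * norm2 z.
  move=> t1; apply: le_trans (cauchy_schwarz y z).
  by rewrite ler_piMr // normc_ge0.
have le2 : norm2 (inner x' a' *: (a' - a)) <= norm2 x' * norm2 (a' - a).
  rewrite norm2Z ler_wpM2r ?norm2_ge0 //.
  apply: le_trans (cauchy_schwarz _ _) _.
  by rewrite ler_piMr ?norm2_ge0 // norm2_normalize_le1.
have le3 : norm2 (inner x' (a' - a) *: a) <= norm2 x' * norm2 (a' - a).
  by rewrite norm2Z le1 // norm2_normalize_le1.
apply: le_trans (norm2D _ _) _; apply: le_trans (lerD le2 le3) _.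
rewrite -mulrDr ler_wpM2l ?norm2_ge0 //; apply: le_trans (lerD na na) _.
by rewrite -!mulrA; lra.
Qed.

(** Rejection does not increase norms, so [M] bounds all intermediate vectors of [w]. By
    [reject_dist] the error of the pivot is then added with weight [4 * M] over the pivot norm, and
    a step multiplies the common error bound by at most [L]. *)
Lemma mgs_dist m v w (M delta L : R) :
  (forall s, (s < m)%N -> mgs w s s != 0) ->
  (forall i, (i < m)%N -> norm2 (w i) <= M) ->
  (forall i, (i < m)%N -> norm2 (v i - w i) <= delta) ->
  (forall s, (s < m)%N -> 1 + 4 * M / norm2 (mgs w s s) <= L) ->
  forall s i, (s <= m)%N -> (i < m)%N ->
  norm2 (mgs v s i - mgs w s i) <= L ^+ s * delta.
Proof.
move=> u0 wM vw wL; elim=> [|s IH] i sm im; first by rewrite mul1r vw.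
apply: le_trans (reject_dist _ _ _ (u0 s sm)) _.
have Es := IH s (ltnW sm) sm; have Ei := IH i (ltnW sm) im.
have d0 := norm2_gt0 (u0 s sm).
have M0 : 0 <= M := le_trans (norm2_ge0 _) (wM i im).
have wi := le_trans (norm2_mgs w s i) (wM i im).
set E := L ^+ s * delta in Es Ei.
have E0 : 0 <= E := le_trans (norm2_ge0 _) Es.
apply: (@le_trans _ _ (E + M * (4 * E / norm2 (mgs w s s)))).
  apply: lerD => //; apply: ler_pM; rewrite ?norm2_ge0 ?divr_ge0 ?mulr_ge0 ?norm2_ge0 //.
  by rewrite ler_pM2r ?invr_gt0 // ler_pM2l.
have -> : L ^+ s.+1 * delta = L * E by rewrite exprS -mulrA.
have -> : E + M * (4 * E / norm2 (mgs w s s)) =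
    (1 + 4 * M / norm2 (mgs w s s)) * E by ring.
by rewrite ler_wpM2r // wL.
Qed.

(** The final normalization costs 2 over the pivot norm, which is again at most [L] because
    [1 <= M]. *)
Lemma gram_schmidt_dist m v w (M delta L : R) : 1 <= M -> 0 <= delta ->
  (forall s, (s < m)%N -> mgs w s s != 0) ->
  (forall i, (i < m)%N -> norm2 (w i) <= M) ->
  (forall i, (i < m)%N -> norm2 (v i - w i) <= delta) ->
  (forall s, (s < m)%N -> 1 + 4 * M / norm2 (mgs w s s) <= L) ->
  forall i, (i < m)%N ->
  norm2 (normalize (mgs v i i) - normalize (mgs w i i)) <= L ^+ m * delta.
Proof.
move=> M1 delta0 u0 wM vw wL i im.
have H := mgs_dist u0 wM vw wL (ltnW im) im.
have d0 := norm2_gt0 (u0 i im).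
apply: le_trans (normalize_dist _ (u0 i im)) _.
have dL := wL i im.
have M4 : 0 <= 4 * M / norm2 (mgs w i i) by rewrite divr_ge0 ?norm2_ge0 //; lra.
have L1 : 1 <= L by apply: le_trans dL; rewrite lerDl.
apply: (@le_trans _ _ (L ^+ i.+1 * delta)); last first.
  by rewrite ler_wpM2r // ler_weXn2l.
rewrite exprS -[L * _ * _]mulrA [2 * _ / _]mulrAC; apply: ler_pM; rewrite ?norm2_ge0 ?divr_ge0 ?norm2_ge0 //.
apply: le_trans dL; apply: (@le_trans _ _ (4 * M / norm2 (mgs w i i))); last by rewrite lerDr.
by rewrite ler_pM2r ?invr_gt0 //; lra.
Qed.

Section Powers.
Variables (T U : l2 R -> l2 R) (K d : R).
Hypotheses (lT : linear T) (K1 : 1 <= K) (d0 : 0 <= d).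
Hypotheses (TK : forall x, norm2 (T x) <= K * norm2 x)
  (UK : forall x, norm2 (U x) <= K * norm2 x)
  (TU : forall x, norm2 (T x - U x) <= d * norm2 x).

Lemma iter_norm2 n x : norm2 (iter n U x) <= K ^+ n * norm2 x.
Proof.
elim: n => [|n IH] /=; first by rewrite mul1r.
apply: le_trans (UK _) _; rewrite exprS -mulrA ler_wpM2l //; exact: le_trans K1.
Qed.

(** Telescoping through [T^(n+1) - U^(n+1) = T (T^n - U^n) + (T - U) U^n]; a spare factor [K >= 1]
    simplifies the constant. *)
Lemma iter_dist n x : norm2 (iter n T x - iter n U x) <= n%:R * K ^+ n * d * norm2 x.
Proof.
have K0 : 0 <= K by exact: le_trans K1.
elim: n => [|n IH] /=; first by rewrite subrr norm2_0 !mul0r.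
apply: le_trans (norm2_dist_triangle _ (T (iter n U x)) _) _.
rewrite -(linB lT); apply: le_trans (lerD (TK _) (TU _)) _.
apply: (@le_trans _ _ (K * (n%:R * K ^+ n * d * norm2 x) + d * (K ^+ n * norm2 x))).
  by apply: lerD; apply: ler_wpM2l => //; exact: iter_norm2.
have -> : n.+1%:R * K ^+ n.+1 * d * norm2 x =
   K * (n%:R * K ^+ n * d * norm2 x) + K * (d * (K ^+ n * norm2 x)).
  by rewrite -natr1 exprS; ring.
rewrite lerD2l ler_peMl // !mulr_ge0 ?exprn_ge0 ?norm2_ge0 //.
Qed.
End Powers.

Lemma norm2_ebasis k : norm2 (e_ k) = 1.
Proof.
apply/eqP; rewrite -(@eqrXn2 _ 2) ?norm2_ge0 //; apply/eqP/complexI.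
by rewrite -innerxx ebasis_orthonormal eqxx expr1n.
Qed.

(** Triangle inequality over the [m ^ 2] entries, each coordinate of [x] being at most 1 in
    modulus. *)
Lemma section_opnorm_le m A B (c : R) : linear A -> linear B -> 0 <= c ->
  (forall i k, (i < m)%N -> (k < m)%N ->
    normc (inner (A (e_ k)) (e_ i) - inner (B (e_ k)) (e_ i)) <= c) ->
  opnorm (fun x => projP m (A (projP m x)) - projP m (B (projP m x)))
    <= m%:R ^+ 2 * c.
Proof.
move=> lA lB c0 ABc; apply: opnorm_le => x x1.
have E : projP m (A (projP m x)) - projP m (B (projP m x)) =
    \sum_(k < m) \sum_(i < m)
      (x k * (inner (A (e_ k)) (e_ i) - inner (B (e_ k)) (e_ i))) *: e_ i.
  rewrite /projP; have -> (y z : l2 R) : trunc m y - trunc m z = trunc m (y - z).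
    by apply: l2P => i; rewrite l2D l2N !truncE; case: ifP => // _; rewrite subr0.
  rewrite [trunc m x]trunc_sum (lin_sum lA) (lin_sum lB) trunc_sum exchange_big /=.
  apply: eq_bigr => i _; rewrite -scaler_suml; congr (_ *: _).
  rewrite l2D l2N !l2_sum -sumrB; apply: eq_bigr => k _.
  by rewrite (linZ lA) (linZ lB) !l2Z !inner_ebasis mulrBr.
rewrite E expr2; apply: le_trans (norm2_sum _ _ _) _.
have -> : m%:R * m%:R * c = \sum_(k < m) \sum_(i < m) c.
  by rewrite !sumr_const !card_ord -[RHS]mulr_natl -[c *+ m]mulr_natl mulrA.
apply: ler_sum => k _; apply: le_trans (norm2_sum _ _ _) _; apply: ler_sum => i _.
rewrite norm2Z norm2_ebasis mulr1 Normc.normcM -[c]mul1r.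
apply: ler_pM; rewrite ?normc_ge0 ?ABc //.
exact: le_trans (normc_le_norm2 _ _) x1.
Qed.

(** * Computable error bound for the IQR section, and control of the pivots *)

Section IterateBounds.
Variables (T U : l2 R -> l2 R) (C : R) (j n m : nat).
Hypotheses (bT : bounded_linear T) (iT : invertible T).
Hypotheses (bU : bounded_linear U) (iU : invertible U).
Hypotheses (TC : opnorm T <= C) (j0 : (0 < j)%N) (n0 : (0 < n)%N).
Hypothesis TU : opnorm (fun x => U x - T x) <= j%:R^-1.

(** A common bound for [T] and [U], whose distance is at most [1/j <= 1]. *)
Let K := C + 1.
Let M := K ^+ n.
Let v i := iter n T (e_ i).
Let w i := iter n U (e_ i).
Let j1 : 0 < j%:R^-1 :> R. Proof. by rewrite invr_gt0 ltr0n. Qed.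
Let C0 : 0 <= C. Proof. by apply: le_trans TC; exact: opnorm_ge0. Qed.
Let K1 : 1 <= K. Proof. by rewrite lerDr. Qed.
Let M1 : 1 <= M. Proof. by rewrite exprn_ege1. Qed.
Let M0 : 0 <= M. Proof. exact: le_trans M1. Qed.

Lemma apply_dist x : norm2 (T x - U x) <= j%:R^-1 * norm2 x.
Proof.
rewrite norm2_distC; apply: le_trans (le_opnorm x (bounded_linearB bU bT)) _.
by rewrite ler_wpM2r ?norm2_ge0.
Qed.

Let TK x : norm2 (T x) <= K * norm2 x.
Proof.
apply: le_trans (le_opnorm x bT) _; rewrite ler_wpM2r ?norm2_ge0 //.
by apply: le_trans TC _; rewrite lerDl.
Qed.

Let UK x : norm2 (U x) <= K * norm2 x.
Proof.
have -> : U x = T x - (T x - U x) by rewrite opprB addrC subrK.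
apply: le_trans (norm2D _ _) _; rewrite norm2N mulrDl.
apply: lerD.
  by apply: le_trans (le_opnorm x bT) _; rewrite ler_wpM2r ?norm2_ge0.
apply: le_trans (apply_dist x) _; rewrite ler_wpM2r ?norm2_ge0 //.
by rewrite invf_le1 ?ler1n ?ltr0n.
Qed.

Let vM i : norm2 (v i) <= M.
Proof. by have := iter_norm2 K1 TK n (e_ i); rewrite norm2_ebasis mulr1. Qed.

Let wM i : norm2 (w i) <= M.
Proof. by have := iter_norm2 K1 UK n (e_ i); rewrite norm2_ebasis mulr1. Qed.

Let vw i : norm2 (v i - w i) <= n%:R * M / j%:R.
Proof.
have [lT _] := bT.
have := iter_dist lT K1 (ltW j1) TK UK apply_dist n (e_ i).
by rewrite norm2_ebasis mulr1.
Qed.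

Lemma mgs_iter_neq0 (A : l2 R -> l2 R) s : bounded_linear A -> invertible A ->
  mgs (fun i => iter n A (e_ i)) s s != 0.
Proof.
move=> bA iA; have [lA _] := iter_bounded n bA; apply: mgs_injective => //.
elim: n => //= k IH; exact: inj_comp (invertible_inj iA) IH.
Qed.

(* An a posteriori bound: besides C, m, n and j it only involves the columns  *)
(* of U^n, which are finitely supported when U = T_(j).                       *)
Lemma iqr_section_dist :
  opnorm (fun x => projP m (iqr n T (projP m x)) - projP m (iqr n U (projP m x)))
  <= m%:R ^+ 2 * (3 * K *
       ((1 + 4 * M ^+ 2 * \sum_(s < m) (norm2 (mgs w s s) ^+ 2)^-1) ^+ m *
        (n%:R * M / j%:R))).
Proof.
set L := 1 + _; set eta := L ^+ m * _.
have K0 : 0 <= K by exact: le_trans K1.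
have S0 (P : pred 'I_m) : 0 <= \sum_(s < m | P s) (norm2 (mgs w s s) ^+ 2)^-1.
  by apply: sumr_ge0 => s _; rewrite invr_ge0 sqr_ge0.
have L1 : 1 <= L by rewrite lerDl !mulr_ge0 ?sqr_ge0 ?S0.
have u0 s : (s < m)%N -> mgs w s s != 0 by move=> _; exact: mgs_iter_neq0.
have wL s : (s < m)%N -> 1 + 4 * M / norm2 (mgs w s s) <= L.
  move=> sm; have d0 := norm2_gt0 (u0 s sm); rewrite lerD2l.
  (* A pivot has norm at most [M], so [M] over its norm is at most the square of that ratio. Squared
     norms are preferred because they can be computed without square roots. *)
  apply: (@le_trans _ _ (4 * M ^+ 2 * (norm2 (mgs w s s) ^+ 2)^-1)).
    have -> : 4 * M ^+ 2 * (norm2 (mgs w s s) ^+ 2)^-1 =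
      4 * M / norm2 (mgs w s s) * (M / norm2 (mgs w s s)).
      by rewrite expr2 invfM; ring.
    rewrite ler_peMr // ?divr_ge0 ?mulr_ge0 ?norm2_ge0 //.
    by rewrite ler_pdivlMr // mul1r; exact: le_trans (norm2_mgs _ _ _) (wM s).
  by rewrite ler_wpM2l ?mulr_ge0 ?sqr_ge0 // (bigD1 (Ordinal sm)) //= lerDl S0.
have delta0 : 0 <= n%:R * M / j%:R by rewrite divr_ge0 ?mulr_ge0.
have qD i : (i < m)%N -> norm2 (normalize (mgs v i i) - normalize (mgs w i i)) <= eta.
  by move=> im; apply: gram_schmidt_dist wL _ im.
(* Here [0 < n] matters: it makes [eta] at least [1/j], so it also absorbs the distance between [T]
   and [U]. *)
have eta_j : j%:R^-1 <= eta.
  apply: (@le_trans _ _ (1 * (1 * 1 * j%:R^-1))); first by rewrite !mul1r.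
  apply: ler_pM; rewrite ?mulr_ge0 ?(ltW j1) ?exprn_ege1 //.
  rewrite ler_wpM2r ?(ltW j1) // ler_pM ?ler1n //.
have [[lT _] _] := iqr_bounded n bT iT; have [[lU _] _] := iqr_bounded n bU iU.
have eta0 : 0 <= eta by exact: le_trans (ltW j1) _.
clearbody eta; apply: section_opnorm_le => //.
  exact: mulr_ge0 (mulr_ge0 (ler0n _ 3) K0) eta0.
move=> i k im km; rewrite !iqr_entry // -/v -/w.
have na := norm2_normalize_le1 (mgs v k k).
have na' := norm2_normalize_le1 (mgs w k k).
have nb' := norm2_normalize_le1 (mgs w i i).
have qk := qD k km; have qi := qD i im.
move: (normalize (mgs v k k)) (normalize (mgs v i i)) (normalize (mgs w k k))
  (normalize (mgs w i i)) na na' nb' qk qi => a b a' b' na na' nb' qk qi.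
(* Change [b], [a] and the operator in turn; each change costs at most [K * eta], hence the factor
   3. *)
have -> : inner (T a) b - inner (U a') b' =
    inner (T a) (b - b') + inner (T a - T a') b' + inner (T a' - U a') b'.
  by rewrite innerBr !innerBl !addrA !subrK.
have CS x y (p q : R) : norm2 x <= p -> norm2 y <= q -> normc (inner x y) <= p * q.
  move=> xp yq; apply: le_trans (cauchy_schwarz _ _) _.
  by apply: ler_pM; rewrite ?norm2_ge0.
have t1 : normc (inner (T a) (b - b')) <= K * eta.
  by apply: CS => //; apply: le_trans (TK _) _; rewrite ler_piMr.
have t2 : normc (inner (T a - T a') b') <= K * eta.
  rewrite -[K * eta]mulr1; apply: CS => //.
  have [lT' _] := bT; rewrite -(linB lT').
  by apply: le_trans (TK _) _; rewrite ler_wpM2l.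
have t3 : normc (inner (T a' - U a') b') <= K * eta.
  rewrite -[K * eta]mulr1; apply: CS => //.
  apply: le_trans (apply_dist _) _.
  apply: (@le_trans _ _ (j%:R^-1 * 1)); first by rewrite ler_wpM2l // ltW.
  by rewrite mulr1; apply: le_trans eta_j _; rewrite ler_peMl.
apply: le_trans (le_normcD _ _) _.
apply: le_trans (lerD (le_normcD _ _) (lexx _)) _.
lra.
Qed.

(* The threshold for j depends on T only, so that the search for j ends.      *)
Lemma iter_pivots_lower :
  let sigma := \sum_(s < m) (norm2 (mgs v s s))^-1 in
  2 * ((1 + 4 * M * sigma) ^+ m * (n%:R * M)) * sigma <= j%:R ->
  forall s, (s < m)%N ->
  (norm2 (mgs w s s) ^+ 2)^-1 <= 4 * (norm2 (mgs v s s) ^+ 2)^-1.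
Proof.
move=> sigma jbig s sm; set L := 1 + 4 * M * sigma in jbig.
have u0 t : (t < m)%N -> mgs v t t != 0 by move=> _; exact: mgs_iter_neq0.
have sle t : (t < m)%N -> (norm2 (mgs v t t))^-1 <= sigma.
  move=> tm; rewrite /sigma (bigD1 (Ordinal tm)) //= lerDl sumr_ge0 // => i _.
  by rewrite invr_ge0 norm2_ge0.
have sigma0 : 0 <= sigma by apply: le_trans (sle s sm); rewrite invr_ge0 norm2_ge0.
have vL t : (t < m)%N -> 1 + 4 * M / norm2 (mgs v t t) <= L.
  by move=> tm; rewrite lerD2l ler_wpM2l ?sle ?mulr_ge0.
have wv t : (t < m)%N -> norm2 (w t - v t) <= n%:R * M / j%:R.
  by rewrite norm2_distC.
have L1 : 1 <= L by rewrite lerDl !mulr_ge0.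
(* The roles are exchanged with respect to [iqr_section_dist]: the pivots of [T] are now in the
   denominators. *)
have H := mgs_dist u0 (fun i _ => vM i) wv vL (ltnW sm) sm.
have d0 := norm2_gt0 (u0 s sm).
set d := norm2 (mgs v s s) in d0 *; set d' := norm2 (mgs w s s).
have j0' : 0 < j%:R :> R by rewrite ltr0n.
(* The threshold on [j] makes the perturbation at most half of the pivot, so a pivot of [U] is at
   least half of that of [T]; squaring the inverse gives the factor 4. *)
have dd : norm2 (mgs w s s - mgs v s s) <= d / 2.
  apply: le_trans H _.
  apply: (@le_trans _ _ (L ^+ m * (n%:R * M / j%:R))).
    by rewrite ler_wpM2r ?divr_ge0 ?mulr_ge0 // ler_weXn2l // ltnW.
  rewrite mulrA ler_pdivrMr //; set X := L ^+ m * _.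
  have X0 : 0 <= X by rewrite mulr_ge0 ?mulr_ge0 // exprn_ge0 // (le_trans ler01).
  have : 2 * X * d^-1 <= j%:R by apply: le_trans jbig; rewrite ler_wpM2l ?sle // mulr_ge0.
  by rewrite ler_pdivrMr //; lra.
have d'2 : d / 2 <= d'.
  have := norm2B_le (mgs v s s) (mgs w s s); rewrite norm2_distC -/d -/d'.
  by move=> h; have := le_trans h dd; lra.
have d'0 : 0 < d' by apply: lt_le_trans d'2; rewrite divr_gt0.
rewrite -[4]invrK -invfM lef_pV2 ?posrE ?exprn_gt0 ?mulr_gt0 ?invr_gt0 //; nra.
Qed.

End IterateBounds.
End Perturbation.

(** * Householder transformations and finite sections *)

Section Householder.
Variable R : realType.
Local Notation C := R[i].
Local Notation normc := (@Normc.normc R).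
Local Open Scope sesquilinear_scope.

Lemma adjmxE N M (A : 'M[C]_(N, M)) i j : A^t* i j = (A j i)^*.
Proof. by rewrite !mxE. Qed.

Lemma sqr_vnorm N (x : 'cV[C]_N) : vnorm x ^+ 2 = \sum_l (x l 0)^* * x l 0.
Proof.
rewrite /vnorm -rmorphXn sqr_sqrtr; last by apply: sumr_ge0 => l _; exact: sqr_ge0.
by rewrite rmorph_sum; apply: eq_bigr => l _; rewrite /= mulrC mul_conjC.
Qed.

Lemma vnorm_ge0 N (x : 'cV[C]_N) : 0 <= vnorm x.
Proof. by rewrite ler0c sqrtr_ge0. Qed.

Lemma vnorm_eq0 N (x : 'cV[C]_N) : vnorm x = 0 -> x = 0.
Proof.
move=> x0; have : vnorm x ^+ 2 = 0 by rewrite x0 expr0n.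
rewrite sqr_vnorm => /eqP; rewrite psumr_eq0; last first.
  by move=> l _; rewrite mulrC mul_conjC ler0c sqr_ge0.
move=> /allP H; apply/matrixP => l k; rewrite ord1 mxE.
have := H l (mem_index_enum _); rewrite mulrC mul_conjC => /eqP/complexI/eqP.
by rewrite sqrf_eq0 => /eqP/Normc.eq0_normc.
Qed.

Lemma conj_vnorm N (x : 'cV[C]_N) : (vnorm x)^* = vnorm x.
Proof. exact: conjC_real_complex. Qed.

Lemma col_mulmx N M P (A : 'M[C]_(N, M)) (B : 'M[C]_(M, P)) k :
  col k (A *m B) = A *m col k B.
Proof.
by apply/matrixP => i j; rewrite !mxE; apply: eq_bigr => l _; rewrite !mxE.
Qed.

Lemma reflection_adj N (v : 'cV[C]_N) : (reflection v)^t* = reflection v.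
Proof.
apply/matrixP => i j; rewrite adjmxE !mxE !big_ord1 !mxE rmorphB rmorphM fmorph_div /=.
rewrite rmorphXn /= conj_vnorm !rmorphM /= conjCK !rmorph_nat eq_sym.
by rewrite [X in _ * X]mulrC.
Qed.

Lemma adj_mul_self N (v : 'cV[C]_N) : v^t* *m v = (vnorm v ^+ 2)%:M.
Proof.
apply/matrixP => i j; rewrite !ord1 !mxE eqxx mulr1n sqr_vnorm.
by apply: eq_bigr => l _; rewrite !mxE.
Qed.

Lemma reflection_unitary N (v : 'cV[C]_N) : reflection v \is unitarymx.
Proof.
apply/unitarymxP; rewrite reflection_adj /reflection; set c := 2 / _; set P := v *m _.
have PP : P *m P = vnorm v ^+ 2 *: P.
  by rewrite /P mulmxA -(mulmxA v) adj_mul_self -scalemx1 -scalemxAr mulmx1 -scalemxAl.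
have cc : c * c * vnorm v ^+ 2 = c + c.
  rewrite /c; have [->|v0] := eqVneq (vnorm v) 0; first by rewrite expr0n invr0 !mulr0 addr0.
  by rewrite -mulrA divfK ?expf_neq0 // mulr_natr mulr2n.
rewrite mulmxBl mul1mx mulmxBr mulmx1 -scalemxAl -scalemxAr PP !scalerA cc scalerDl.
by rewrite opprB addrK subrK.
Qed.

Lemma phase_mul (z : C) : phase z * `|z| = z.
Proof.
rewrite /phase; case: eqVneq => [->|z0]; first by rewrite normr0 mulr0.
by rewrite divfK // normr_eq0.
Qed.

Lemma phase_conj (z : C) : phase z * (phase z)^* = 1.
Proof.
rewrite /phase; case: eqVneq => [_|z0]; first by rewrite rmorph1 mulr1.
rewrite -normCK normrM normfV normr_id divff ?expr1n //.
by rewrite normr_eq0.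
Qed.

Lemma phase_conj_mul (z : C) : (phase z)^* * z = `|z|.
Proof. by rewrite -{2}(phase_mul z) mulrA [_^* * _]mulrC phase_conj mul1r. Qed.

Lemma reflection_orth N (v h : 'cV[C]_N) :
  \sum_l (v l 0)^* * h l 0 = 0 -> reflection v *m h = h.
Proof.
move=> vh; rewrite mulmxBl mul1mx -scalemxAl -mulmxA.
have -> : v^t* *m h = 0.
  apply/matrixP => i j; rewrite !ord1 !mxE -[RHS]vh.
  by apply: eq_bigr => l _; rewrite !mxE.
by rewrite mulmx0 scaler0 subr0.
Qed.

(** With [v] the reflection vector, [v^* x] is half of the squared norm of [v], so the reflection
    subtracts exactly [v] from [x]. The phase rules out cancellation: this number vanishes only for
    [x = 0]. *)
Lemma reflection_target N (i : 'I_N) (x : 'cV[C]_N) :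
  let ph := phase (x i 0) in
  reflection (x + (ph * vnorm x) *: delta_mx i 0) *m x
    = - ((ph * vnorm x) *: delta_mx i 0).
Proof.
move=> ph; set d := _ *: delta_mx i 0; set v := x + d.
have vx : v^t* *m x = (vnorm x * (vnorm x + `|x i 0|))%:M.
  apply/matrixP => a b; rewrite !ord1 !mxE eqxx mulr1n.
  rewrite (eq_bigr (fun l => (x l 0)^* * x l 0 + (d l 0)^* * x l 0)); last first.
    by move=> l _; rewrite !mxE rmorphD mulrDl.
  rewrite big_split /= -sqr_vnorm expr2 mulrDr; congr (_ + _).
  rewrite (bigD1 i) //= big1 ?addr0.
    rewrite !mxE !eqxx mulr1 rmorphM /= conj_vnorm mulrAC phase_conj_mul.
    by rewrite mulrC.
  by move=> l /negbTE li; rewrite !mxE li mulr0 rmorph0 mul0r.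
have vv : vnorm v ^+ 2 = (vnorm x * (vnorm x + `|x i 0|)) *+ 2.
  have := adj_mul_self v; rewrite {2}/v mulmxDr vx => /matrixP/(_ 0 0).
  rewrite [in LHS]mxE ![(_%:M) 0 0]mxE !eqxx !mulr1n => <-; rewrite mulr2n; congr (_ + _).
  rewrite mxE (bigD1 i) //= big1 ?addr0.
    rewrite adjmxE !mxE !eqxx mulr1 rmorphD rmorphM /= conj_vnorm.
    have -> : ((x i 0)^* + ph^* * vnorm x) * (ph * vnorm x) =
      (x i 0)^* * ph * vnorm x + (ph * ph^*) * vnorm x * vnorm x by ring.
    rewrite phase_conj mul1r mulrDr addrC; congr (_ + _).
    rewrite -[X in X * _](conjCK) rmorphM /= conjCK mulrC [_ * ph^*]mulrC phase_conj_mul.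
    by rewrite conj_Creal // realE normr_ge0.
  by move=> l /negbTE li; rewrite !mxE li mulr0 mulr0.
rewrite mulmxBl mul1mx -scalemxAl -mulmxA vx -scalemx1 -scalemxAr mulmx1 scalerA vv.
have [x0|x0] := eqVneq (vnorm x) 0.
  by rewrite /d x0 !(mulr0, mul0r, scale0r) subr0 oppr0 (vnorm_eq0 x0).
have s0 : vnorm x + `|x i 0| != 0.
  by rewrite gt_eqF // ltr_wpDr // lt0r x0 vnorm_ge0.
have half (s : C) : s != 0 -> 2 / (s *+ 2) * s = 1.
  by move=> ?; rewrite -[s *+ 2]mulr_natl invfM mulrA divff ?pnatr_eq0 // mul1r mulVf.
by rewrite half ?mulf_neq0 // scale1r /v opprD addrA subrr add0r.
Qed.

Section Step.
Variables (N : nat) (i : 'I_N) (A : 'M[C]_N).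
Hypothesis upA : forall l k : 'I_N, (k < i)%N -> (k < l)%N -> A l k = 0.

Let x : 'cV[C]_N := \col_l (if (i <= l)%N then A l i else 0).

Lemma householderE :
  householder i A = reflection (x + (phase (x i 0) * vnorm x) *: delta_mx i 0).
Proof. by rewrite /householder [x i 0]mxE leqnn. Qed.

(** The reflection vector lives on coordinates [>= i], where the finished columns [k < i] are
    already zero. *)
Lemma householder_left (l k : 'I_N) : (k < i)%N -> (householder i A *m A) l k = A l k.
Proof.
move=> ki; have := @reflection_orth _ (x + (phase (x i 0) * vnorm x) *: delta_mx i 0) (col k A).
rewrite -householderE => H.
have {}H : householder i A *m col k A = col k A.
  apply: H; apply: big1 => t _; rewrite !mxE.
  case: (leqP i t) => it; first by rewrite (upA ki (leq_trans ki it)) mulr0.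
  have -> : (t == i) = false by apply/negbTE; rewrite -val_eqE /= neq_ltn it.
  by rewrite mulr0 addr0 rmorph0 mul0r.
by have := congr1 (fun B : 'cV_N => B l 0) H; rewrite -col_mulmx !mxE.
Qed.

(** The part of the column above row [i] is orthogonal to the reflection vector and stays fixed; the
    rest is sent to a multiple of the basis vector [i]. *)
Lemma householder_column (l : 'I_N) : (i < l)%N -> (householder i A *m A) l i = 0.
Proof.
move=> il; pose h : 'cV[C]_N := \col_l (if (i <= l)%N then 0 else A l i).
have colE : col i A = h + x.
  by apply/matrixP => a b; rewrite !mxE; case: ifP; rewrite ?add0r ?addr0.
have E : col i (householder i A *m A) = h - (phase (x i 0) * vnorm x) *: delta_mx i 0.
  rewrite col_mulmx colE mulmxDr householderE reflection_target reflection_orth //.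
  apply: big1 => t _; rewrite !mxE; case: (leqP i t) => it; first by rewrite mulr0.
  have -> : (t == i) = false by apply/negbTE; rewrite -val_eqE /= neq_ltn it.
  by rewrite mulr0 addr0 rmorph0 mul0r.
have := congr1 (fun B : 'cV_N => B l 0) E; rewrite mxE => ->.
rewrite !mxE (ltnW il) (_ : (l == i) = false) ?mulr0 ?subrr //.
by apply/negbTE; rewrite -val_eqE /= neq_ltn il orbT.
Qed.

Lemma householder_posE l k : (householder_pos i A *m A) l k =
  (if l == i then (phase ((householder i A *m A) i i))^* else 1)
    * (householder i A *m A) l k.
Proof. by rewrite /householder_pos -mulmxA mul_diag_mx mxE mxE. Qed.

Lemma householder_pos_left (l k : 'I_N) : (k < i)%N -> (k < l)%N ->
  (householder_pos i A *m A) l k = 0.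
Proof. by move=> ki kl; rewrite householder_posE (householder_left l ki) upA ?mulr0. Qed.

Lemma householder_pos_diag (k : 'I_N) : (k < i)%N ->
  (householder_pos i A *m A) k k = A k k.
Proof.
move=> ki; rewrite householder_posE (householder_left k ki) (_ : (k == i) = false) ?mul1r //.
by apply/negbTE; rewrite -val_eqE /= neq_ltn ki.
Qed.

Lemma householder_pos_column (l : 'I_N) : (i < l)%N -> (householder_pos i A *m A) l i = 0.
Proof. by move=> il; rewrite householder_posE (householder_column il) mulr0. Qed.

Lemma householder_pos_ge0 : 0 <= (householder_pos i A *m A) i i.
Proof. by rewrite householder_posE eqxx phase_conj_mul normr_ge0. Qed.

Lemma householder_pos_unitary : householder_pos i A \is unitarymx.
Proof.
apply: mul_unitarymx; last exact: reflection_unitary.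
apply/unitarymxP/matrixP => a b; rewrite mul_diag_mx !mxE.
have [->|ab] := eqVneq a b; last first.
  by rewrite ?(negbTE ab) ?[b == a]eq_sym ?(negbTE ab) mulr0n rmorph0 mulr0.
rewrite ?eqxx !mulr1n; case: eqP => _; last by rewrite rmorph1 mulr1.
by rewrite conjCK mulrC phase_conj.
Qed.

End Step.

Lemma filter_enum_ord N K (KN : (K < N)%N) :
  [seq i : 'I_N <- enum 'I_N | (i < K.+1)%N] =
  rcons [seq i : 'I_N <- enum 'I_N | (i < K)%N] (Ordinal KN).
Proof.
apply: (inj_map val_inj); rewrite map_rcons /=.
have E M : (M <= N)%N -> [seq val i | i <- [seq i : 'I_N <- enum 'I_N | (i < M)%N]] = iota 0 M.
  move=> MN; rewrite -(filter_map val (fun i => i < M)%N) val_enum_ord.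
  by have := @filter_iota_ltn 0 N M MN; rewrite add0n.
by rewrite !E // 1?ltnW // -cats1 -addn1 iotaD.
Qed.

Lemma householder_unitary_spec N K (A : 'M[C]_N) : (K <= N)%N ->
  let U := householder_unitary K A in
  [/\ U \is unitarymx,
      forall l k : 'I_N, (k < K)%N -> (k < l)%N -> (U *m A) l k = 0
    & forall k : 'I_N, (k < K)%N -> 0 <= (U *m A) k k].
Proof.
elim: K => [|K IH] KN.
  rewrite /householder_unitary (eq_filter (a2 := pred0)) ?filter_pred0 //=.
  by split=> //; apply/unitarymxP; rewrite mul1mx trmx1 map_mx1.
have [uU upU posU] := IH (ltnW KN).
rewrite /householder_unitary (filter_enum_ord KN) foldl_rcons.
rewrite -/(householder_unitary K A); set U := householder_unitary K A in uU upU posU *.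
set i := Ordinal KN; split.
- exact: mul_unitarymx (householder_pos_unitary _ _) uU.
- move=> l k; rewrite ltnS leq_eqVlt -mulmxA => /orP[/eqP ki|ki] kl.
    have {ki} ki : k = i by exact: val_inj.
    by rewrite ki in kl *; exact: householder_pos_column.
  exact: householder_pos_left.
- move=> k; rewrite ltnS leq_eqVlt -mulmxA => /orP[/eqP ki|ki].
    by have -> : k = i; [exact: val_inj|exact: householder_pos_ge0].
  by rewrite householder_pos_diag // posU.
Qed.

End Householder.

(** * Exactness of the Householder procedure on finite sections *)

Section FiniteSections.
Variable R : realType.
Local Notation C := R[i].
Local Notation e_ := (ebasis R).
Implicit Types (x y : l2 R) (B S : l2 R -> l2 R).
Local Open Scope sesquilinear_scope.

(** Matrix entries indexed by naturals, 0 outside the matrix, to match the families indexed by [nat]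
    in [mgs_unique]. *)
Definition entry N (A : 'M[C]_N) (i k : nat) : C :=
  if (insub i, insub k) is (Some i', Some k') then A i' k' else 0.

Lemma entryE N (A : 'M[C]_N) (i k : 'I_N) : entry A i k = A i k.
Proof. by rewrite /entry !valK. Qed.

Lemma leadingE N K (A : 'M[C]_N) i k : leading K A i k = entry A i k.
Proof. by rewrite mxE. Qed.

(** The first [K] columns of [B] fit entirely into [N] rows, so [A = U^* (U A)] expands them
    triangularly in the columns of [U^*]. Uniqueness identifies these with the Gram-Schmidt vectors,
    and the block of [U A U^*] is the formula of [iqr_entry] for one step. *)
Lemma householder_step_section N K B :
  bounded_linear B -> invertible B -> (K <= N)%N ->
  (forall k l, (k < K)%N -> (N <= l)%N -> B (e_ k) l = 0) ->
  householder_step K (section_mx N B) = section_mx K (iqr_step B).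
Proof.
move=> bB iB KN supB; have [lB _] := bB.
set A := section_mx N B; have [] := householder_unitary_spec A KN.
set U := householder_unitary K A => /unitarymxP uU upUA posUA.
have uU' : U^t* *m U = 1%:M by exact: mulmx1C.
(* Column [i] of [U^*], extended by zeros to a vector of [l2]. *)
pose h (i : nat) := trunc N (fun l => (entry U i l)^*) : l2 R.
have hE i (l : 'I_N) : h i l = (entry U i l)^* by rewrite truncE ltn_ord.
have h_expand i : h i = \sum_(l < N) (entry U i l)^* *: e_ l.
  have -> : h i = trunc N (h i) by apply: l2P => l; rewrite !truncE; case: (l < N)%N.
  by rewrite trunc_sum; apply: eq_bigr => l _; rewrite hE.
have inner_h x i : inner x (h i) = \sum_(l < N) x l * entry U i l.
  rewrite h_expand inner_sumr; apply: eq_bigr => l _.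
  by rewrite innerZr conjCK inner_ebasis mulrC.
have AE (l k : 'I_N) : A l k = B (e_ k) l by rewrite mxE inner_ebasis.
have ordK i : (i < K)%N -> exists i' : 'I_N, i = i'.
  by move=> iK; exists (Ordinal (leq_trans iK KN)).
have oh : orthonormal_upto K h.
  move=> i k /ordK[i' ->] /ordK[k' ->]; rewrite inner_h.
  transitivity ((U *m U^t*) k' i'); last by rewrite uU mxE eq_sym.
  rewrite mxE; apply: eq_bigr => l _.
  by rewrite hE !entryE !mxE mulrC.
have columns k : (k < K)%N ->
    B (e_ k) = \sum_(i < k.+1) entry (U *m A) i k *: h i.
  move=> kK; have [k' kE] := ordK k kK; rewrite kE in kK *.
  have -> : B (e_ k') = \sum_(i < N) (U *m A) i k' *: h i.
    apply: l2P => l; rewrite l2_sum; case: (ltnP l N) => lN; last first.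
      rewrite supB // big1 // => i _.
      by rewrite l2Z truncE ltnNge lN mulr0.
    transitivity ((U^t* *m (U *m A)) (Ordinal lN) k').
      by rewrite mulmxA uU' mul1mx AE.
    rewrite mxE; apply: eq_bigr => i _.
    by rewrite l2Z (hE i (Ordinal lN)) entryE adjmxE mulrC.
  rewrite -(big_mkord xpredT (fun i => entry (U *m A) i k' *: h i)).
  rewrite (eq_bigr (fun i : 'I_N => entry (U *m A) i k' *: h i)); last first.
    by move=> i _; rewrite entryE.
  rewrite -(big_mkord xpredT (fun i => entry (U *m A) i k' *: h i)).
  rewrite (big_cat_nat _ (ltn_ord k')) //= [X in _ + X]big_nat [X in _ + X]big1 ?addr0 ?big_mkord //.
  move=> i /andP[ki iN]; by rewrite (entryE _ (Ordinal iN) k') upUA ?scale0r.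
have hq i : (i < K)%N -> h i = normalize (mgs (fun k => B (e_ k)) i i).
  move=> iK.
  have [] // := @mgs_unique _ K (fun k => B (e_ k)) h (entry (U *m A)) oh columns _ _ i iK.
  - by move=> k kK; have [k' kE] := ordK k kK; rewrite kE in kK *; rewrite entryE posUA.
  (* Householder only gives a nonnegative diagonal; that the pivots are nonzero comes from
     injectivity of [B]. *)
  - by move=> k _; left; apply: mgs_injective => //; exact: invertible_inj.
apply/matrixP => i k; rewrite leadingE [RHS]mxE.
rewrite -[iqr_step B]/(iqr 1 B) iqr_entry //= -!hq //.
rewrite inner_h h_expand (lin_sum lB).
have [i' iE] := ordK i (ltn_ord i); have [k' kE] := ordK k (ltn_ord k).
rewrite iE kE entryE mxE.
rewrite (eq_bigr (fun l : 'I_N => \sum_(t < N) U i' t * A t l * (U k' l)^*)); last first.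
  by move=> l _; rewrite !mxE mulr_suml.
rewrite exchange_big /=; apply: eq_bigr => t _.
rewrite l2_sum mulr_suml; apply: eq_bigr => l _.
rewrite (linZ lB) l2Z !entryE AE; ring.
Qed.

(** The argument is [k.+1] because [f] counts columns from 1 while [e_ k] counts from 0. *)
Definition column_control (f : nat -> nat) B :=
  forall k l, (f k.+1 <= l)%N -> B (e_ k) l = 0.

Definition control_mono (f : nat -> nat) :=
  forall k k', (0 < k <= k')%N -> (f k <= f k')%N.

Lemma column_control_support f B x N : linear B ->
  control_mono f -> column_control f B -> (0 < N)%N ->
  (forall k, (N <= k)%N -> x k = 0) -> forall l, (f N <= l)%N -> B x l = 0.
Proof.
move=> lB fm cB N0 x0 l fl.
have -> : x = trunc N x by apply: l2P => k; rewrite truncE; case: ltnP => // /x0.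
rewrite trunc_sum (lin_sum lB) l2_sum big1 // => k _.
rewrite (linZ lB) l2Z cB ?mulr0 // (leq_trans _ fl) //; apply: fm.
by rewrite /= ltn_ord.
Qed.

Lemma upper_triangular_support S y N : linear S -> upper_triangular S ->
  (forall k, (N <= k)%N -> y k = 0) -> forall l, (N <= l)%N -> S y l = 0.
Proof.
move=> lS tS y0 l Nl.
have -> : y = trunc N y by apply: l2P => k; rewrite truncE; case: ltnP => // /y0.
rewrite trunc_sum (lin_sum lS) l2_sum big1 // => k _.
by rewrite (linZ lS) l2Z -(inner_ebasis (S _)) tS ?mulr0 // (leq_trans _ Nl).
Qed.

(** By [mgs_image], [Q (e_ k)] is the image under [B] of a vector supported on the first [k + 1]
    coordinates, hence obeys the control, and the upper triangular factor does not enlarge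
    supports. *)
Lemma iqr_step_control f B : bounded_linear B -> invertible B ->
  control_mono f -> column_control f B -> column_control f (iqr_step B).
Proof.
move=> bB iB fm cB k; have [lB _] := bB.
have [Q [S [qr ->]]] := iqr_stepE bB iB.
have [_ [lQ _ _] [[lS _] _ tS _]] := qr.
have [x xE xk] := mgs_image k k lB.
rewrite /= (qr_mgs qr) xE /normalize (linZ lS).
move=> l fl; rewrite l2Z (upper_triangular_support lS tS _ fl) ?mulr0 //.
apply: column_control_support => // t kt.
by rewrite xk ?(ltnW kt) // gtn_eqF.
Qed.

(** Dimension count: otherwise [k] columns in a space of dimension [f k < k] would be dependent,
    against injectivity. *)
Lemma control_ge_id f B : bounded_linear B -> invertible B ->
  control_mono f -> column_control f B -> forall k, (0 < k)%N -> (k <= f k)%N.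
Proof.
move=> [lB _] iB fm cB k k0; rewrite leqNgt; apply/negP => fk.
pose A : 'M[C]_(k, f k) := \matrix_(t, l) B (e_ t) l.
have : kermx A != 0.
  rewrite -mxrank_eq0 mxrank_ker subn_eq0 -ltnNge.
  exact: leq_ltn_trans (rank_leq_col A) fk.
move=> /rowV0Pn[c /sub_kermxP cA c0].
have := invertible_inj iB; set x := \sum_(t < k) c 0 t *: e_ t => injB.
have xt (t : 'I_k) : (x : l2 R) t = c 0 t.
  rewrite l2_sum (bigD1 t) //= l2Z ebasisE eqxx mulr1 big1 ?addr0 // => s st.
  by rewrite l2Z ebasisE -val_eqE eq_sym in st *; rewrite (negbTE st) mulr0.
have x0 : x = 0.
  apply: injB; rewrite (lin0 lB); apply: l2P => l; rewrite l20.
  case: (ltnP l (f k)) => lf; last first.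
    apply: column_control_support lf => // t kt.
    by rewrite l2_sum big1 // => s _; rewrite l2Z ebasisE gtn_eqF ?mulr0 // (leq_trans _ kt).
  have := congr1 (fun D : 'rV_(f k) => D 0 (Ordinal lf)) cA.
  rewrite !mxE => <-; rewrite (lin_sum lB) l2_sum; apply: eq_bigr => t _.
  by rewrite (linZ lB) l2Z mxE.
apply/negP: c0; rewrite negbK; apply/eqP/matrixP => a t.
by rewrite ord1 mxE -xt x0.
Qed.

Lemma iter_control_gt0 f n m : (forall k, (0 < k)%N -> (k <= f k)%N) ->
  (0 < m)%N -> (0 < iter n f m)%N.
Proof. by move=> fge m0; elim: n => //= n IH; exact: leq_trans (fge _ IH). Qed.

Lemma householder_iqr_section f n m B : bounded_linear B -> invertible B ->
  control_mono f -> column_control f B -> (0 < m)%N ->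
  section_mx m (iqr n B) = householder_iqr f n m (section_mx (iter n f m) B).
Proof.
elim: n B => //= n IH B bB iB fm cB m0.
have fge := control_ge_id bB iB fm cB.
have K0 := iter_control_gt0 n fge m0.
have [bB' iB'] := iqr_step_bounded bB iB.
rewrite (@householder_step_section (f (iter n f m))) //; last first.
- by move=> k l kK fl; apply: cB; apply: leq_trans fl; apply: fm.
- exact: fge.
rewrite -IH //; last exact: iqr_step_control.
congr section_mx; exact: iterSr.
Qed.

End FiniteSections.

(** * The search for j *)

Section Algorithm.

Local Notation "f $ x" := (TmApp f x) (at level 12, left associativity).
Local Notation "'fn' t" := (TmLam t) (at level 90, t at level 90).
Local Notation num := TyNum.
Local Notation nat' := TyNat.

Definition tvar0 {G a} : tm (a :: G) a := TmVar (VarZ G a).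
Definition tvar1 {G a b} : tm [:: b, a & G] a := TmVar (VarS b (VarZ G a)).
Definition tvar2 {G a b c} : tm [:: c, b, a & G] a :=
  TmVar (VarS c (VarS b (VarZ G a))).
Definition tvar3 {G a b c d} : tm [:: d, c, b, a & G] a :=
  TmVar (VarS d (VarS c (VarS b (VarZ G a)))).
Definition tvar4 {G a b c d e} : tm [:: e, d, c, b, a & G] a :=
  TmVar (VarS e (VarS d (VarS c (VarS b (VarZ G a))))).

Fixpoint tnat {G} (k : nat) : tm G nat' :=
  if k is k'.+1 then TmSucc G $ tnat k' else TmZero G.
Definition tnum {G} (k : nat) : tm G num := TmOfNat G $ tnat k.
Definition tadd {G} (x y : tm G num) : tm G num := TmAdd G $ x $ y.
Definition tmul {G} (x y : tm G num) : tm G num := TmMul G $ x $ y.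
Definition trec {G a} (x : tm G a) f k : tm G a := TmRec G a $ x $ f $ k.

Definition tsum {G} : tm G ((nat' ~> num) ~> nat' ~> num) :=
  fn fn trec (tnum 0) (fn fn tadd tvar0 (tvar3 $ tvar1)) tvar0.

Definition tpow {G} : tm G (num ~> nat' ~> num) :=
  fn fn trec (tnum 1) (fn fn tmul tvar0 tvar3) tvar0.

Definition tleq {G} : tm G (nat' ~> nat' ~> num) :=
  fn fn TmOfNat _ $ (TmLeq _ $ (TmOfNat _ $ tvar1) $ (TmOfNat _ $ tvar0)).

(* In the following terms the first argument k stands for j = k + 1. *)

Definition tsize {G} : tm G (nat' ~> nat') :=
  fn trec (TmParM _) (fn fn TmControl _ $ (TmSucc _ $ tvar2) $ tvar0) (TmParN _).

(** Entry of [T_(j)]: that of [T], multiplied by the 0-1 indicator that the row survives the cut of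
    its column. *)
Definition tcoef {G} : tm G (nat' ~> nat' ~> nat' ~> num) :=
  fn fn fn tmul
    (tleq $ (TmSucc _ $ tvar1) $ (TmControl _ $ (TmSucc _ $ tvar2) $ (TmSucc _ $ tvar0)))
    (TmEntry _ $ tvar1 $ tvar0).

(** Column of [T_(j)^n], by [n] matrix-vector products starting from an indicator vector. All sums
    stop at [tsize], which bounds the supports that occur for the first [m] columns. *)
Definition tcolumn {G} : tm G (nat' ~> nat' ~> nat' ~> num) :=
  fn fn trec (fn tmul (tleq $ tvar0 $ tvar1) (tleq $ tvar1 $ tvar0))
    (fn fn fn tsum $ (fn tmul (tcoef $ TmVar (VarS _ (VarS _ (VarS _ (VarS _ (VarS _ (VarZ _ _))))))
                                 $ tvar1 $ tvar0) (tvar2 $ tvar0))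
                   $ (tsize $ tvar4)) (TmParN _).

Definition tgram {G} : tm G (nat' ~> nat' ~> nat' ~> num) :=
  fn fn fn tsum $ (fn tmul (tcolumn $ tvar3 $ tvar2 $ tvar0)
                           (TmConj _ $ (tcolumn $ tvar3 $ tvar1 $ tvar0)))
                $ (tsize $ tvar2).

(* Schur complements of the Gram matrix of the columns of T_(j)^n are the Gram *)
(* matrices of the partially orthogonalized columns [mgs _ s], so the pivots   *)
(* are the numbers |mgs _ s s|^2, obtained without square roots.               *)
Definition tschur {G} : tm G (nat' ~> nat' ~> nat' ~> nat' ~> num) :=
  fn fn trec (tgram $ tvar1)
    (fn fn fn fn tadd (tvar2 $ tvar1 $ tvar0)
       (TmOpp _ $ (tmul (tmul (tvar2 $ tvar1 $ tvar3) (TmInv _ $ (tvar2 $ tvar3 $ tvar3)))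
                        (tvar2 $ tvar3 $ tvar0)))) tvar0.

Definition tsigma {G} : tm G (nat' ~> num) :=
  fn tsum $ (fn TmInv _ $ (tschur $ tvar1 $ tvar0 $ tvar0 $ tvar0)) $ TmParM _.

Definition tK {G} : tm G num := tadd (TmBound _) (tnum 1).
Definition tM {G} : tm G num := tpow $ tK $ TmParN _.
Definition tL {G} : tm G (nat' ~> num) :=
  fn tadd (tnum 1) (tmul (tmul (tnum 4) (tpow $ tM $ tnat 2)) (tsigma $ tvar0)).

(** The bound of [iqr_section_dist] compared with epsilon, after multiplication by [j = k + 1]. *)
Definition ttest {G} : tm G (nat' ~> nat') :=
  fn TmLeq _
    $ tmul (tpow $ (TmOfNat _ $ TmParM _) $ tnat 2)
        (tmul (tmul (tnum 3) tK)
           (tmul (tpow $ (tL $ tvar0) $ TmParM _) (tmul (TmOfNat _ $ TmParN _) tM)))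
    $ tmul (TmOfNat _ $ (TmSucc _ $ tvar0)) (TmEps _).

Definition iqr_algorithm : algorithm := Algorithm ttest (TmSucc [::]).

End Algorithm.

(** * Meaning of the program terms *)

Section AlgorithmSemantics.
Variable R : realType.
Local Notation C := R[i].
Local Notation normc := (@Normc.normc R).
Local Notation e_ := (ebasis R).
Implicit Types (x y u : l2 R) (v w : nat -> l2 R).

Lemma prim_rec_sum (f : nat -> C) N :
  prim_rec (0%:R : C) (fun i acc => acc + f i) N = \sum_(i < N) f i.
Proof. by elim: N => [|N IH]; rewrite ?big_ord0 // big_ord_recr /= -IH. Qed.

Lemma prim_rec_pow (c : C) N : prim_rec (1%:R : C) (fun _ acc => acc * c) N = c ^+ N.
Proof. by elim: N => [|N IH] //; rewrite exprSr -IH. Qed.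

Lemma prim_rec_iter (X : Type) (x0 : X) (f : X -> X) N :
  prim_rec x0 (fun _ => f) N = iter N f x0.
Proof. by elim: N => //= N ->. Qed.

(** One rejection acts on Gram matrices as a Schur complement; this is the recursion of [tschur]. *)
Lemma inner_reject2 u x y :
  inner (reject u x) (reject u y) =
  inner x y - inner x u * (inner u u)^-1 * inner u y.
Proof.
by rewrite {2}/reject innerBr innerZr reject_orth mulr0 subr0 innerBl innerZl.
Qed.

Section Run.
Variables (T U : l2 R -> l2 R) (g : nat -> nat -> nat) (cst eps : R) (m n k : nat).
Hypotheses (bU : bounded_linear U) (iU : invertible U).
Hypothesis gm : control_mono (g k.+1).
Hypothesis UT : forall l, U (e_ l) = projP (g k.+1 l.+1) (T (e_ l)).

Let I := operator_input T g cst eps m n.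
Let N := iter n (g k.+1) m.
Let w i := iter n U (e_ i).
Let lU : linear U. Proof. by have [] := bU. Qed.
Let cU : column_control (g k.+1) U.
Proof. by move=> l i gi; rewrite UT truncE ltnNge gi. Qed.

Lemma denote_tsize G (r : env R G) : denote I tsize r k = N.
Proof. exact: prim_rec_iter. Qed.

Lemma denote_tleq G (r : env R G) i l : denote I tleq r i l = (i <= l)%:R :> C.
Proof. by rewrite /= ler_nat. Qed.

Lemma denote_tsum G (r : env R G) f M : denote I tsum r f M = \sum_(i < M) f i.
Proof. exact: prim_rec_sum. Qed.

Lemma denote_tpow G (r : env R G) c M : denote I tpow r c M = c ^+ M.
Proof. exact: prim_rec_pow. Qed.

Lemma denote_tcoef G (r : env R G) i l : denote I tcoef r k i l = U (e_ l) i.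
Proof.
transitivity (denote I tleq r i.+1 (g k.+1 l.+1) * inner (T (e_ l)) (e_ i)); first by [].
rewrite denote_tleq inner_ebasis UT truncE.
by case: ltnP; rewrite ?mul1r ?mul0r.
Qed.

Lemma iter_support s i l : (0 < m)%N -> (i < m)%N -> (iter s (g k.+1) m <= l)%N ->
  iter s U (e_ i) l = 0.
Proof.
move=> m0 im; have fge := control_ge_id bU iU gm cU.
elim: s l => [|s IH] l /= fl.
  by rewrite ebasisE gtn_eqF // (leq_trans im).
exact: column_control_support lU gm cU (iter_control_gt0 _ fge m0) IH _ fl.
Qed.

Lemma iter_size_le s : (0 < m)%N -> (s <= n)%N -> (iter s (g k.+1) m <= N)%N.
Proof.
move=> m0 sn; have fge := control_ge_id bU iU gm cU.
rewrite /N -(subnK sn); elim: (n - s)%N => [|t IH] //.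
by rewrite addSn /=; exact: leq_trans IH (fge _ (iter_control_gt0 _ fge m0)).
Qed.

Lemma denote_tcolumn G (r : env R G) i a : (i < m)%N ->
  denote I tcolumn r k i a = w i a.
Proof.
move=> im; have m0 : (0 < m)%N by case: (m) im.
pose step (d : nat -> C) a := \sum_(l < N) U (e_ l) a * d l.
transitivity (prim_rec (fun l => (l <= i)%:R * (i <= l)%:R : C) (fun _ => step) n a).
  have -> : (fun l => (l <= i)%:R * (i <= l)%:R : C) =
      (fun l => denote I tleq r l i * denote I tleq r i l).
    by apply/funext => l; rewrite !denote_tleq.
  have -> : step = fun d a => denote I tsum r (fun l => denote I tcoef r k a l * d l)
      (denote I tsize r k).
    apply/funext => d; apply/funext => b; rewrite denote_tsum denote_tsize.
    by apply: eq_bigr => l _; rewrite denote_tcoef.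
  by [].
(* The number of iterations becomes a variable [s <= n], while the truncation size [N] stays
   fixed. *)
rewrite /w; move: (leqnn n); move: {1 3 4}n => s; elim: s a => [|s IH] a sn /=.
  by rewrite ebasisE; case: ltngtP; rewrite ?mulr1 ?mul0r ?mulr0.
transitivity (step (iter s U (e_ i)) a).
  by apply: eq_bigr => l _; rewrite IH // ltnW.
(* Earlier iterates are supported below [N] as well, so the finite product is the exact action of
   [U]. *)
have -> : iter s U (e_ i) = trunc N (iter s U (e_ i)).
  apply: l2P => l; rewrite truncE; case: ltnP => // Nl.
  by rewrite iter_support // (leq_trans (iter_size_le m0 (ltnW sn))).
rewrite trunc_sum (lin_sum lU) l2_sum; apply: eq_bigr => l _.
by rewrite (linZ lU) l2Z -trunc_sum truncE ltn_ord mulrC.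
Qed.

Lemma denote_tgram G (r : env R G) i t : (i < m)%N -> (t < m)%N ->
  denote I tgram r k i t = inner (w i) (w t).
Proof.
move=> im tm; have m0 : (0 < m)%N by case: (m) im.
transitivity (denote I tsum r (fun l => denote I tcolumn r k i l *
    (denote I tcolumn r k t l)^*) (denote I tsize r k)); first by [].
rewrite denote_tsum denote_tsize (@inner_finiter _ _ _ N).
  by apply: eq_bigr => l _; rewrite !denote_tcolumn.
by move=> l Nl; rewrite /w iter_support.
Qed.

Lemma denote_tschur G (r : env R G) s i t : (s < m)%N -> (i < m)%N -> (t < m)%N ->
  denote I tschur r k s i t = inner (mgs w s i) (mgs w s t).
Proof.
move=> sm im tm.
transitivity (prim_rec (denote I tgram r k)
   (fun s (D : nat -> nat -> C) i t => D i t - D i s * (D s s)^-1 * D s t) s i t); first by [].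
elim: s i t sm im tm => [|s IH] i t sm im tm; first exact: denote_tgram.
by rewrite /= !IH ?(ltnW sm) // inner_reject2.
Qed.

Lemma denote_tsigma G (r : env R G) :
  denote I tsigma r k = (\sum_(s < m) (norm2 (mgs w s s) ^+ 2)^-1)%:C%C.
Proof.
transitivity (denote I tsum r (fun s => (denote I tschur r k s s s)^-1) m); first by [].
rewrite denote_tsum rmorph_sum; apply: eq_bigr => s _.
by rewrite denote_tschur // innerxx fmorphV.
Qed.

Lemma denote_ttest G (r : env R G) :
  denote I ttest r k =
  (m%:R ^+ 2 * (3 * (cst + 1) *
       ((1 + 4 * ((cst + 1) ^+ n) ^+ 2 *
           \sum_(s < m) (norm2 (mgs w s s) ^+ 2)^-1) ^+ m *
        (n%:R * (cst + 1) ^+ n))) <= k.+1%:R * eps :> R).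
Proof.
pose K : C := cst%:C%C + 1%:R.
transitivity (nat_of_bool (denote I tpow r (m%:R : C) 2 * (3%:R * K *
  (denote I tpow r (1%:R + 4%:R * denote I tpow r (denote I tpow r K n) 2
      * denote I tsigma r k) m * (n%:R * denote I tpow r K n)))
  <= k.+1%:R * eps%:C%C :> C)); first by [].
rewrite !denote_tpow denote_tsigma /K -lecR; congr nat_of_bool; congr (_ <= _).
  by rewrite !(rmorphM, rmorphXn, rmorphD, rmorph1, rmorph_nat).
by rewrite rmorphM rmorph_nat.
Qed.

End Run.
End AlgorithmSemantics.

(** * The search ends *)

Section Termination.
Variable R : realType.
Local Notation e_ := (ebasis R).

(* All constants in the test are bounded independently of j, because the      *)
(* pivots of T_(j)^n converge to the nonzero pivots of T^n.                   *)
Lemma test_eventually (T : l2 R -> l2 R) (Tj : nat -> l2 R -> l2 R) (C eps : R)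
    (m n : nat) :
  bounded_linear T -> invertible T ->
  (forall j, (0 < j)%N -> bounded_linear (Tj j) /\ invertible (Tj j)) ->
  (forall j, (0 < j)%N -> opnorm (fun x => Tj j x - T x) <= j%:R^-1) ->
  opnorm T <= C -> 0 < eps -> (0 < n)%N ->
  exists k : nat,
  m%:R ^+ 2 * (3 * (C + 1) *
     ((1 + 4 * ((C + 1) ^+ n) ^+ 2 *
        \sum_(s < m)
          (norm2 (mgs (fun i => iter n (Tj k.+1) (e_ i)) s s) ^+ 2)^-1) ^+ m *
      (n%:R * (C + 1) ^+ n))) <= k.+1%:R * eps.
Proof.
move=> bT iT bj close TC eps0 n0.
pose v i := iter n T (e_ i).
pose M := (C + 1) ^+ n.
have C0 : 0 <= C by apply: le_trans TC; exact: opnorm_ge0.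
have K0 : 0 <= C + 1 by rewrite addr_ge0.
have M0 : 0 <= M by rewrite exprn_ge0.
pose sigma := \sum_(s < m) (norm2 (mgs v s s))^-1.
pose X := 2 * ((1 + 4 * M * sigma) ^+ m * (n%:R * M)) * sigma.
pose S := \sum_(s < m) 4 * (norm2 (mgs v s s) ^+ 2)^-1.
pose Y := m%:R ^+ 2 * (3 * (C + 1) * ((1 + 4 * M ^+ 2 * S) ^+ m * (n%:R * M))).
(* Large enough for two purposes: [X] is the threshold of [iter_pivots_lower], and [Y] bounds the
   left side of the test once the pivots are controlled. *)
pose k := Num.truncn (`|X| + `|Y / eps|).
have kbig : `|X| + `|Y / eps| <= k.+1%:R.
  by rewrite ltW // truncnS_gt // addr_ge0.
have kX : X <= k.+1%:R.
  by apply: le_trans (ler_norm _) (le_trans _ kbig); rewrite lerDl.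
have kY : Y <= k.+1%:R * eps.
  rewrite -ler_pdivrMr //.
  by apply: le_trans (ler_norm _) (le_trans _ kbig); rewrite lerDr.
exists k; have [bU iU] := bj k.+1 isT.
have lower := iter_pivots_lower (j := k.+1) bT iT bU TC isT (close k.+1 isT) kX.
apply: le_trans kY; rewrite -/M.
have S1 : \sum_(s < m)
    (norm2 (mgs (fun i => iter n (Tj k.+1) (e_ i)) s s) ^+ 2)^-1 <= S.
  by apply: ler_sum => s _; exact: lower.
have S0 : 0 <= \sum_(s < m)
    (norm2 (mgs (fun i => iter n (Tj k.+1) (e_ i)) s s) ^+ 2)^-1.
  by apply: sumr_ge0 => s _; rewrite invr_ge0 sqr_ge0.
apply: ler_wpM2l; first exact: sqr_ge0.
apply: ler_wpM2l; first by rewrite mulr_ge0.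
apply: ler_wpM2r; first by rewrite mulr_ge0.
have a0 : 0 <= 4 * M ^+ 2 by rewrite mulr_ge0 ?sqr_ge0.
have b0 := mulr_ge0 a0 S0; have c0 := mulr_ge0 a0 (le_trans S0 S1).
by apply: lerXn2r; rewrite ?nnegrE ?addr_ge0 // lerD2l ler_wpM2l.
Qed.

End Termination.

Theorem theorem4p8 (R : realType) :
  exists p : algorithm,
  forall (T : l2 R -> l2 R) (g : nat -> nat -> nat) (Tj : nat -> l2 R -> l2 R)
    (C epsilon : R) (m n : nat),
  bounded_linear T -> invertible T -> column_decay T g Tj ->
  opnorm T <= C -> 0 < epsilon -> (0 < m)%N -> (0 < n)%N ->
  exists j : nat,
    [/\ (0 < j)%N,
        outputs p (operator_input T g C epsilon m n) j,
        section_mx m (iqr n (Tj j)) =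
          householder_iqr (g j) n m (section_mx (iter n (g j) m) (Tj j)) &
        opnorm (fun x => projP m (iqr n T (projP m x)) - projP m (iqr n (Tj j) (projP m x)))
          <= epsilon].
Proof.
exists iqr_algorithm => T g Tj C eps m n bT iT decay TC eps0 m0 n0.
have bU := decay_bounded decay; have iU := decay_invertible decay.
have gm j : (0 < j)%N -> control_mono (g j).
  by move=> j0 a b ab; exact: decay_mono decay _ _ _ j0 ab.
have UT j l : (0 < j)%N -> Tj j (ebasis R l) = projP (g j l.+1) (T (ebasis R l)).
  by move=> j0; exact: decay_columns decay j l.+1 j0 isT.
have cU j : (0 < j)%N -> column_control (g j) (Tj j).
  by move=> j0 l i gi; rewrite UT // truncE ltnNge gi.
set I := operator_input T g C eps m n.
pose test k : bool := denote I (halt_test iqr_algorithm) tt k != 0%N.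
have testE k := denote_ttest (G := [::]) C eps m n (bU k.+1 isT) (iU k.+1 isT)
  (gm k.+1 isT) (fun l => UT k.+1 l isT) tt.
have [k0 k0P] := test_eventually m bT iT (fun j j0 => conj (bU j j0) (iU j j0))
  (decay_close decay) TC eps0 n0.
have ex_test : exists k, test k.
  by exists k0; rewrite /test (testE k0) k0P.
(* The search returns the least successful [k], possibly smaller than the witness [k0]; the error
   estimate below relies only on the test having succeeded. *)
case: (ex_minnP ex_test) => k test_k k_min.
exists k.+1; split=> //.
- exists k; split=> //; first exact/eqP.
  move=> k' k'k; apply/eqP; apply: contraTT k'k => tk'.
  by rewrite -leqNgt; exact: k_min.
- by apply: householder_iqr_section => //; [exact: bU|exact: iU|exact: gm|exact: cU].
have := iqr_section_dist m bT iT (bU k.+1 isT) (iU k.+1 isT) TC (j := k.+1) isT n0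
  (decay_close decay (j := k.+1) isT).
move=> /le_trans; apply.
have : denote I (halt_test iqr_algorithm) tt k != 0%N by exact: test_k.
rewrite (testE k) eqb0 negbK => H.
(* Multiplication by [j] turns the a posteriori bound into the inequality that was tested. *)
rewrite -(ler_pM2l (x := k.+1%:R)) ?ltr0n //; apply: le_trans H.
rewrite le_eqVlt; apply/orP; left; apply/eqP.
by field; rewrite ?pnatr_eq0.
Qed.
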